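(* For all indices $\mathbf r,\mathbf s\in\mathbf I$ and every integer $N\ge0$, $$\widehat{\gamma_N}(x_{\mathbf r}\ast x_{\mathbf s})=\sum_{k=0}^N\widehat{\gamma_k}(x_{\mathbf r})\,\widehat{\gamma_{N-k}}(x_{\mathbf s}).$$
   Context: Let $r$ be a power of a prime $p$, $A=\mathbb F_r[\theta]$, $\mathbb C_\infty$ the completion of an algebraic closure of $\mathbb F_r((1/\theta))$; $A_{+,d}$ the monic polynomials of degree $d$. Carlitz module $a\mapsto\mathbf C_a(X)\in A[X]$ with $\mathbf C_\theta(X)=\theta X+X^r$; $[a]_u=\mathbf C_a(u)/u\in A[u]$. $\mathbf I$: finite tuples of positive integers including $\varnothing$. $H_d(s;u)=\sum_{a\in A_{+,d}}[a]_u^{-s}$ and $H_{<d}(\mathbf s;u)=\sum_{d>d_1>\cdots>d_m\ge0}\prod_jH_{d_j}(s_j;u)$ as formal power series in $\mathbb C_\infty[[u]]$, $H_{<d}(\varnothing;u)=1$; their coefficient-wise limit as $d\to\infty$ exists and equals $\zeta_u(\mathbf s)=\sum_{N\ge0}\gamma_N(\mathbf s)u^{N(r-1)}$, which defines $\gamma_N(\mathbf s)\in\mathbb C_\infty$ (with $\gamma_N(\varnothing)=\delta_{N,0}$). $\widehat{\gamma_N}:\mathcal R\to\mathbb C_\infty$ is the $\mathbb F_p$-linear map $x_{\mathbf s}\mapsto\gamma_N(\mathbf s)$. The $r$-shuffle algebra $(\mathcal R,\ast)$: $\mathcal R$ is the $\mathbb F_p$-vector space on the free monoid on $x_k$ ($k\in\mathbb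 N$), $x_{\mathbf s}=x_{s_1}\cdots x_{s_m}$, $x_\varnothing=1$, $\mathbf s^-=(s_2,\dots,s_m)$; for $r_1,s_1\in\mathbb N$ and positive $i,j$, $\Delta^{i,j}_{r_1,s_1}=(-1)^{r_1-1}\binom{j-1}{r_1-1}+(-1)^{s_1-1}\binom{j-1}{s_1-1}$ if $(r-1)\mid j$, else $0$ (mod $p$); $\ast$ is $\mathbb F_p$-bilinear with $1\ast x_{\mathbf s}=x_{\mathbf s}\ast1=x_{\mathbf s}$ and, for non-empty $\mathbf r,\mathbf s$, $x_{\mathbf r}\ast x_{\mathbf s}=x_{r_1}(x_{\mathbf r^-}\ast x_{\mathbf s})+x_{s_1}(x_{\mathbf r}\ast x_{\mathbf s^-})+x_{r_1+s_1}(x_{\mathbf r^-}\ast x_{\mathbf s^-})+\sum_{i+j=r_1+s_1}\Delta^{i,j}_{r_1,s_1}x_i((x_{\mathbf r^-}\ast x_{\mathbf s^-})\ast x_j)$ (recursion on total depth; juxtaposition is concatenation). *)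

(* Defs.v *)
From HB Require Import structures.
From mathcomp Require Import all_boot all_order all_algebra.
From mathcomp Require Import boolp classical_sets reals finmap monalg.

Set Implicit Arguments.
Unset Strict Implicit.
Unset Printing Implicit Defensive.

Import Order.TTheory GRing.Theory Num.Theory.
Local Open Scope ring_scope.

Record fps (K : fieldType) := Fps { fcoef : nat -> K }.

HB.instance Definition _ (K : fieldType) := gen_eqMixin (fps K).
HB.instance Definition _ (K : fieldType) := gen_choiceMixin (fps K).

Section Fps.
Variable K : fieldType.
Implicit Types f g h : fps K.

Lemma fpsP f g : fcoef f =1 fcoef g <-> f = g.
Proof. by case: f g => [f] [g]; split=> [/funext /= ->|[->]]. Qed.

Definition fps_zero : fps K := Fps (fun=> 0).
Definition fps_opp f := Fps (fun n => - fcoef f n).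
Definition fps_add f g := Fps (fun n => fcoef f n + fcoef g n).
Definition fps_one : fps K := Fps (fun n => (n == 0%N)%:R).
Definition fps_mul f g :=
  Fps (fun n => \sum_(i < n.+1) fcoef f i * fcoef g (n - i)%N).

Fact fps_addA : associative fps_add.
Proof. by move=> f g h; apply/fpsP => n /=; rewrite addrA. Qed.
Fact fps_addC : commutative fps_add.
Proof. by move=> f g; apply/fpsP => n /=; rewrite addrC. Qed.
Fact fps_add0 : left_id fps_zero fps_add.
Proof. by move=> f; apply/fpsP => n /=; rewrite add0r. Qed.
Fact fps_addN : left_inverse fps_zero fps_opp fps_add.
Proof. by move=> f; apply/fpsP => n /=; rewrite addNr. Qed.

HB.instance Definition _ :=
  GRing.isZmodule.Build (fps K) fps_addA fps_addC fps_add0 fps_addN.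

Fact fps_mulC : commutative fps_mul.
Proof.
move=> f g; apply/fpsP => n /=; rewrite (reindex_inj rev_ord_inj) /=.
by apply: eq_bigr => i _; rewrite subSS (sub_ordK i) mulrC.
Qed.

Fact fps_mul_rev f g n :
  fcoef (fps_mul f g) n = \sum_(i < n.+1) fcoef f (n - i)%N * fcoef g i.
Proof.
by rewrite fps_mulC /=; apply: eq_bigr => i _; rewrite mulrC.
Qed.

Fact fps_mulA : associative fps_mul.
Proof.
move=> f g h; apply/fpsP => i; rewrite [RHS]fps_mul_rev [LHS]/=.
pose coef3 j k := fcoef f j * (fcoef g (i - j - k)%N * fcoef h k).
transitivity (\sum_(j < i.+1) \sum_(k < i.+1 | (k <= i - j)%N) coef3 j k).
  apply: eq_bigr => /= j _; rewrite [X in _ * X]fps_mul_rev big_distrr /=.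
  by rewrite (big_ord_narrow_leq (leq_subr _ _)).
rewrite (exchange_big_dep predT) //=; apply: eq_bigr => k _.
transitivity (\sum_(j < i.+1 | (j <= i - k)%N) coef3 j k).
  apply: eq_bigl => j; rewrite -ltnS -(ltnS j) -!subSn ?leq_ord //.
  by rewrite -subn_gt0 -(subn_gt0 j) -!subnDA addnC.
rewrite (big_ord_narrow_leq (leq_subr _ _)) big_distrl /=.
by apply: eq_bigr => j _; rewrite /coef3 -!subnDA addnC mulrA.
Qed.

Fact fps_mul1 : left_id fps_one fps_mul.
Proof.
move=> f; apply/fpsP => n /=; rewrite big_ord_recl subn0 mul1r.
by rewrite big1 ?addr0 // => j _; rewrite mul0r.
Qed.

Fact fps_mulDl : left_distributive fps_mul fps_add.
Proof.
move=> f g h; apply/fpsP => n /=; rewrite -big_split.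
by apply: eq_bigr => j _; rewrite mulrDl.
Qed.

Fact fps_oner_neq0 : fps_one != 0.
Proof.
by apply/eqP => /fpsP /(_ 0%N) /= /eqP; rewrite oner_eq0.
Qed.

HB.instance Definition _ := GRing.Zmodule_isComNzRing.Build (fps K)
  fps_mulA fps_mulC fps_mul1 fps_mulDl fps_oner_neq0.

Lemma fcoefD f g n : fcoef (f + g) n = fcoef f n + fcoef g n.
Proof. by []. Qed.

Lemma fcoefM f g n :
  fcoef (f * g) n = \sum_(i < n.+1) fcoef f i * fcoef g (n - i)%N.
Proof. by []. Qed.

(* The first n coefficients b_0, b_1, ... of 1 / f, computed from
   f_0 * b_m = - \sum_(i < m) f_(m - i) * b_i. *)
Fixpoint fps_inv_seq f n : seq K :=
  if n is m.+1 then
    let s := fps_inv_seq f m in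
    rcons s ((fcoef f 0)^-1 *
             ((m == 0%N)%:R - \sum_(i < m) fcoef f (m - i)%N * s`_i))
  else [::].

Definition fps_inv f : fps K :=
  if fcoef f 0 == 0 then f else Fps (fun n => (fps_inv_seq f n.+1)`_n).

Definition fps_unit : pred (fps K) := fun f => fcoef f 0 != 0.

Fact size_fps_inv_seq f n : size (fps_inv_seq f n) = n.
Proof. by elim: n => //= n IHn; rewrite size_rcons IHn. Qed.

Fact fps_inv_seq_nth f n i :
  (i < n)%N -> (fps_inv_seq f n)`_i = (fps_inv_seq f i.+1)`_i.
Proof.
elim: n => // n IHn; rewrite ltnS leq_eqVlt => /predU1P[-> //|lt_in].
by rewrite -IHn //= nth_rcons size_fps_inv_seq lt_in.
Qed.

Fact fps_mulVr : {in fps_unit, left_inverse 1 fps_inv *%R}.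
Proof.
move=> f; rewrite unfold_in => f0; apply/fpsP => n.
rewrite mulrC /fps_inv (negPf f0) fcoefM big_ord_recl subn0 [fcoef (Fps _) n]/=.
rewrite nth_rcons size_fps_inv_seq ltnn eqxx mulVKf // -addrA.
rewrite [fcoef 1 n]/= -[RHS]addr0; congr (_ + _).
apply/eqP; rewrite addrC subr_eq0; apply/eqP.
rewrite (reindex_inj rev_ord_inj) /=; apply: eq_bigr => i _.
by rewrite /bump leq0n add1n subnSK // subKn 1?ltnW // [RHS]mulrC mulrC fps_inv_seq_nth.
Qed.

Fact fps_intro_unit f g : g * f = 1 -> fps_unit f.
Proof.
move=> /fpsP /(_ 0%N); rewrite fcoefM big_ord1 /= => gf1.
by apply/negP => /eqP f0; move/eqP: gf1; rewrite f0 mulr0 eq_sym oner_eq0.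
Qed.

Fact fps_inv_out : {in [predC fps_unit], fps_inv =1 id}.
Proof. by move=> f; rewrite inE unfold_in negbK /fps_inv => ->. Qed.

HB.instance Definition _ := GRing.ComNzRing_hasMulInverse.Build (fps K)
  fps_mulVr fps_intro_unit fps_inv_out.

Fact fps_lead f : f != 0 ->
  exists2 n, fcoef f n != 0 & forall i, (i < n)%N -> fcoef f i = 0.
Proof.
move=> fN0; have exn : exists n, fcoef f n != 0.
  apply: contrapT => noex; move/eqP: fN0; apply; apply/fpsP => n /=.
  by apply/eqP; apply/negPn/negP => fn; apply: noex; exists n.
case: (ex_minnP exn) => n fn minn; exists n => // i lt_in.
by apply/eqP; apply: contraTT lt_in => fi; rewrite -leqNgt minn.
Qed.

Fact fps_mul_eq0 f g : f * g = 0 -> (f == 0) || (g == 0).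
Proof.
move=> fg0; apply: contrapT => /negP; rewrite negb_or => /andP[].
move=> /fps_lead[m fm minm] /fps_lead[n gn minn].
move/fpsP: fg0 => /(_ (m + n)%N); rewrite fcoefM /= => /eqP.
have ltm : (m < (m + n).+1)%N by rewrite ltnS leq_addr.
rewrite (bigD1 (Ordinal ltm)) //= big1 ?addr0 => [|i neq_im].
  by rewrite addKn mulf_eq0 (negPf fm) (negPf gn).
have [lt_im|le_mi] := ltnP i m; first by rewrite minm ?mul0r.
have lt_mi : (m < i)%N by rewrite ltn_neqAle le_mi andbT eq_sym.
by rewrite minn ?mulr0 // ltn_subLR 1?ltn_add2r // -ltnS.
Qed.

HB.instance Definition _ :=
  GRing.ComUnitRing_isIntegral.Build (fps K) fps_mul_eq0.

Definition fps_of_poly (P : {poly K}) : fps K := Fps (fun n => P`_n).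

End Fps.

(* F((1/theta)), realized as the fraction field of F[[1/theta]]; the series
   variable of [fps F] stands for 1/theta. *)
Definition Kinfty (F : finFieldType) := {fraction fps F}.

Definition invtheta (F : finFieldType) : fps F := fps_of_poly 'X.

(* A = F[theta] -> F((1/theta)), theta |-> 1 / (1/theta). *)
Definition A_to_Kinfty (F : finFieldType) (a : {poly F}) : Kinfty F :=
  (map_poly (fun c => tofrac (fps_of_poly c%:P)) a).[(tofrac (invtheta F))^-1].

(* The completion of an algebraic closure of F((1/theta)). The absolute value
   is the extension of the one of F((1/theta)), normalized by |theta| = #|F|:
   it is determined there by its value at 1/theta and by |f| = 1 for the units
   f of F[[1/theta]]. *)
Record Cinfty (R : realType) (F : finFieldType) := MkCinfty {
  kbar : closedFieldType;
  to_kbar : {rmorphism Kinfty F -> kbar};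
  kbar_algebraic : forall x : kbar, algebraicOver to_kbar x;
  ccar :> fieldType;
  of_kbar : {rmorphism kbar -> ccar};
  cabs : ccar -> R;
  cabs_ge0 : forall x, 0 <= cabs x;
  cabs_eq0 : forall x, cabs x = 0 -> x = 0;
  cabsM : forall x y, cabs (x * y) = cabs x * cabs y;
  cabsD : forall x y, cabs (x + y) <= Num.max (cabs x) (cabs y);
  cabs_unit : forall f : fps F, f \is a GRing.unit ->
    cabs (of_kbar (to_kbar (tofrac f))) = 1;
  cabs_invtheta :
    cabs (of_kbar (to_kbar (tofrac (invtheta F)))) = #|F|%:R^-1;
  kbar_dense : forall (x : ccar) (e : R), 0 < e ->
    exists y : kbar, cabs (x - of_kbar y) < e;
  ccar_complete : forall v : nat -> ccar,
    (forall e : R, 0 < e -> exists n0 : nat, forall m n : nat,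
       (n0 <= m)%N -> (n0 <= n)%N -> cabs (v m - v n) < e) ->
    exists l : ccar, forall e : R, 0 < e -> exists n0 : nat, forall n : nat,
       (n0 <= n)%N -> cabs (v n - l) < e
}.

Record posint := PosInt { posval :> nat; _ : (0 < posval)%N }.

HB.instance Definition _ := [isSub for posval].
HB.instance Definition _ := [Countable of posint by <:].

(* [pos n] is n for n > 0; the value at 0 is irrelevant. *)
Definition pos (n : nat) : posint := insubd (@PosInt 1 isT) n.

Definition Index := seq posint.

Section ZetaU.
Variables (R : realType) (F : finFieldType) (C : Cinfty R F).

Definition iota_A (a : {poly F}) : C := of_kbar C (to_kbar C (A_to_Kinfty a)).

(* C_theta(X) = theta X + X^r; the polynomial variable of {poly F} is theta. *)
Definition carlitz_theta : {poly {poly F}} := 'X%:P * 'X + 'X^#|F|.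

(* C_a is F-linear in a, and C_(theta^i) is the i-th compositional iterate of
   C_theta. *)
Definition carlitz (a : {poly F}) : {poly {poly F}} :=
  \sum_(i < size a)
    (a`_i)%:P *: iter i (fun P => carlitz_theta \Po P) 'X.

(* [a]_u = C_a(u) / u *)
Definition bracket (a : {poly F}) : {poly {poly F}} := drop_poly 1 (carlitz a).

Definition bracket_fps (a : {poly F}) : fps C :=
  fps_of_poly (map_poly iota_A (bracket a)).

Definition Hd (d : nat) (s : posint) : fps C :=
  \sum_(a : {poly_d.+1 F} | (polyn a \is monic) && (size (polyn a) == d.+1))
    bracket_fps a ^- s.

Definition Hlt (d : nat) (s : Index) : fps C :=
  \sum_(k : (size s).-tuple 'I_d | sorted gtn [seq val i | i <- k])
    \prod_(j < size s) Hd (tnth k j) (tnth (in_tuple s) j).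

Definition climit (v : nat -> C) (l : C) : Prop :=
  forall e : R, 0 < e -> exists n0 : nat, forall n : nat,
    (n0 <= n)%N -> cabs (v n - l) < e.

Definition clim (v : nat -> C) : C := xget 0 [set l | climit v l]%classic.

Definition zeta_u (s : Index) : fps C :=
  Fps (fun n => clim (fun d => fcoef (Hlt d s) n)).

Definition gamma (N : nat) (s : Index) : C :=
  fcoef (zeta_u s) (N * (#|F| - 1))%N.

End ZetaU.

(* The F_p-vector space on words; the product of the ring [shuffle_space] is
   the concatenation product. *)
Notation shuffle_space p := {malg 'F_p[{fmonom posint}]}.

Definition xword (p : nat) (s : Index) : shuffle_space p := << FMonom s >>.

Section Shuffle.
Variables (p r : nat).
Implicit Types (s t : Index) (f g : shuffle_space p).

(* The coefficient Delta^{i,j}_{r1,s1}; it does not depend on i. *)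
Definition Delta (r1 s1 j : nat) : 'F_p :=
  if (r - 1 %| j)%N then
    (-1) ^+ (r1 - 1) * 'C(j - 1, r1 - 1)%:R
      + (-1) ^+ (s1 - 1) * 'C(j - 1, s1 - 1)%:R
  else 0.

Definition bilin (op : Index -> Index -> shuffle_space p) f g :=
  \sum_(v <- msupp f) \sum_(w <- msupp g) (f@_v * g@_w) *: op v w.

(* The product of two words, by recursion on a bound n of the total depth:
   each recursive call is on words of strictly smaller total depth. *)
Fixpoint shuffle_rec (n : nat) (s t : Index) : shuffle_space p :=
  match s, t, n with
  | [::], _, _ => xword p t
  | _, [::], _ => xword p s
  | s1 :: s', t1 :: t', m.+1 =>
      xword p [:: s1] * shuffle_rec m s' t
    + xword p [:: t1] * shuffle_rec m s t'
    + xword p [:: pos (s1 + t1)] * shuffle_rec m s' t'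
    + \sum_(1 <= i < s1 + t1)
        let j := (s1 + t1 - i)%N in
        Delta s1 t1 j *:
          (xword p [:: pos i] *
           bilin (shuffle_rec m) (shuffle_rec m s' t') (xword p [:: pos j]))
  | _, _, 0 => 0
  end.

Definition shuffle_word s t := shuffle_rec (size s + size t) s t.

Definition shuffle f g : shuffle_space p := bilin shuffle_word f g.

Lemma bilinw (op : Index -> Index -> shuffle_space p) f g
    (d1 d2 : {fset {fmonom posint}}) :
  (msupp f `<=` d1)%fset -> (msupp g `<=` d2)%fset ->
  bilin op f g = \sum_(v <- d1) \sum_(w <- d2) (f@_v * g@_w) *: op v w.
Proof.
move=> sub1 sub2; rewrite /bilin.
rewrite [RHS](bigID (fun v => v \in msupp f)) /=.
rewrite [X in _ + X]big1 ?addr0 => [|v /mcoeff_outdom fv0]; last first.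
  by rewrite big1 // => w _; rewrite fv0 mul0r scale0r.
rewrite -[RHS]big_filter.
transitivity (\sum_(v <- [seq v <- d1 | v \in msupp f])
                 \sum_(w <- msupp g) (f@_v * g@_w) *: op v w).
  apply: perm_big; apply: uniq_perm; rewrite ?filter_uniq ?fset_uniq // => v.
  rewrite mem_filter; case: (boolP (v \in msupp f)) => //= vf.
  by rewrite (fsubsetP sub1).
apply: eq_bigr => v _; rewrite [RHS](bigID (fun w => w \in msupp g)) /=.
rewrite [X in _ + X]big1 ?addr0 => [|w /mcoeff_outdom gw0]; last first.
  by rewrite gw0 mulr0 scale0r.
rewrite -[RHS]big_filter.
apply: perm_big; apply: uniq_perm; rewrite ?filter_uniq ?fset_uniq // => w.
rewrite mem_filter; case: (boolP (w \in msupp g)) => //= wg.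
by rewrite (fsubsetP sub2).
Qed.

Lemma shuffle_linearl c f1 f2 g :
  shuffle (c *: f1 + f2) g = c *: shuffle f1 g + shuffle f2 g.
Proof.
pose d := (msupp (c *: f1 + f2) `|` msupp f1 `|` msupp f2)%fset.
rewrite /shuffle !(@bilinw _ _ _ d (msupp g)) //; last first.
- by rewrite /d -fsetUA fsubsetUl.
- by rewrite /d fsetUAC fsubsetUr.
- by rewrite /d fsubsetUr.
rewrite scaler_sumr -big_split; apply: eq_bigr => v _.
rewrite scaler_sumr -big_split; apply: eq_bigr => w _.
by rewrite mcoeffD mcoeffZ mulrDl scalerDl scalerA mulrA.
Qed.

Lemma shuffle_linearr c f g1 g2 :
  shuffle f (c *: g1 + g2) = c *: shuffle f g1 + shuffle f g2.
Proof.
pose d := (msupp (c *: g1 + g2) `|` msupp g1 `|` msupp g2)%fset.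
rewrite /shuffle !(@bilinw _ _ _ (msupp f) d) //; last first.
- by rewrite /d -fsetUA fsubsetUl.
- by rewrite /d fsetUAC fsubsetUr.
- by rewrite /d fsubsetUr.
rewrite scaler_sumr -big_split; apply: eq_bigr => v _.
rewrite scaler_sumr -big_split; apply: eq_bigr => w _.
by rewrite mcoeffD mcoeffZ mulrDr scalerDl scalerA mulrCA.
Qed.

Lemma bilinx op f t :
  bilin op f (xword p t) = \sum_(v <- msupp f) f@_v *: op v t.
Proof.
apply: eq_bigr => v _.
by rewrite /xword msuppU1 big_seq_fset1 mcoeffUU mulr1.
Qed.

Lemma shuffle_xword s t : shuffle (xword p s) (xword p t) = shuffle_word s t.
Proof.
by rewrite /shuffle bilinx msuppU1 big_seq_fset1 mcoeffUU scale1r.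
Qed.

Lemma xword_cat s t : xword p (s ++ t) = xword p s * xword p t.
Proof.
rewrite malgME !msuppU1 !big_seq_fset1 !mcoeffUU mulr1; congr << _ *g _ >>.
by rewrite [RHS]fmmulE.
Qed.

Lemma xword0 : xword p [::] = 1.
Proof. by rewrite /xword -fmoneE. Qed.

Fact shuffle_rec_supp n s t (w : {fmonom posint}) :
  w \in msupp (shuffle_rec n s t) -> (size w <= size s + size t)%N.
Proof.
have suppx u v : v \in msupp (xword p u) -> size v = size u.
  by rewrite msuppU1 inE => /eqP->.
have suppM u f k : (forall v, v \in msupp f -> (size v <= k)%N) ->
    forall v, v \in msupp (xword p u * f) -> (size v <= size u + k)%N.
  move=> fk v /msuppM_le[v1 [v2 [/suppx v1E /fk v2k ->]]].
  by rewrite [X in size (fmonom_val X)]fmmulE size_cat v1E leq_add2l.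
have suppD f g k : (forall v, v \in msupp f -> (size v <= k)%N) ->
    (forall v, v \in msupp g -> (size v <= k)%N) ->
    forall v, v \in msupp (f + g) -> (size v <= k)%N.
  move=> fk gk v /(fsubsetP (msuppD_le _ _)).
  by rewrite in_fsetU => /orP[/fk|/gk].
have suppZ c f k : (forall v, v \in msupp f -> (size v <= k)%N) ->
    forall v, v \in msupp (c *: f) -> (size v <= k)%N.
  by move=> fk v /(fsubsetP (msuppZ_le _ _))/fk.
have supp0 k v : v \in msupp (0 : shuffle_space p) -> (size v <= k)%N.
  by rewrite msupp0.
elim: n s t w => [|n IHn] [|s1 s] [|t1 t] w //=;
  try by move=> /suppx->; rewrite ?addn0.
  exact: supp0.
move: w; apply: (suppD); [apply: (suppD); [apply: (suppD)|]|].
- by move=> v /(suppM _ _ _ (IHn _ _)).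
- move=> v /(suppM _ _ _ (IHn _ _)) /leq_trans-> //=.
  by rewrite !addSn !addnS.
- move=> v /(suppM _ _ _ (IHn _ _)) /leq_trans-> //=.
  by rewrite !addSn !addnS !ltnS leqW.
elim/big_ind: _ => [||i _]; first exact: supp0.
  by move=> f g; exact: (suppD).
apply: (suppZ) => v.
have bilinle u w : u \in msupp (bilin (shuffle_rec n)
    (shuffle_rec n s t) (xword p [:: w])) -> (size u <= size s + size t + 1)%N.
  move: u; rewrite bilinx big_seq; elim/big_ind: _ => [||u /IHn us].
  - exact: supp0.
  - by move=> f g; exact: (suppD).
  apply: suppZ => u' /IHn /leq_trans->//=.
  by rewrite leq_add2r.
move=> /(suppM _ _ _ (fun u => bilinle u _)) /leq_trans-> //=.
by rewrite addn1 add1n addSn addnS.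
Qed.

Fact shuffle_rec_stable n m s t :
  (size s + size t <= n)%N -> (size s + size t <= m)%N ->
  shuffle_rec n s t = shuffle_rec m s t.
Proof.
elim: n m s t => [|n IHn] [|m] s t.
- reflexivity.
- by rewrite leqn0 addn_eq0 !size_eq0 => /andP[/eqP-> /eqP->].
- by move=> _; rewrite leqn0 addn_eq0 !size_eq0 => /andP[/eqP-> /eqP->].
case: s => [|s1 s]; first by [].
case: t => [|t1 t]; first by [].
rewrite [size _]/= [size (t1 :: t)]/= !addSn !addnS !ltnS => stn stm.
rewrite [LHS]/= [RHS]/=.
have -> : shuffle_rec n s (t1 :: t) = shuffle_rec m s (t1 :: t).
  by apply: IHn; rewrite /= addnS.
have -> : shuffle_rec n (s1 :: s) t = shuffle_rec m (s1 :: s) t.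
  by apply: IHn; rewrite /= addSn.
have -> : shuffle_rec n s t = shuffle_rec m s t.
  by apply: IHn; rewrite ltnW.
have key j : bilin (shuffle_rec n) (shuffle_rec m s t) (xword p [:: j]) =
             bilin (shuffle_rec m) (shuffle_rec m s t) (xword p [:: j]).
  rewrite !bilinx; apply: eq_big_seq => v /shuffle_rec_supp v_le.
  apply: congr1.
  by apply: IHn; rewrite /= addn1; apply: leq_ltn_trans v_le _.
apply: congr1; apply: eq_bigr => i _.
by apply: congr1; apply: congr1; apply: key.
Qed.

Lemma shuffle0x s : shuffle (xword p [::]) (xword p s) = xword p s.
Proof. by rewrite shuffle_xword; case: s. Qed.

Lemma shufflex0 s : shuffle (xword p s) (xword p [::]) = xword p s.
Proof. by rewrite shuffle_xword; case: s. Qed.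

Lemma shuffle_cons (s1 t1 : posint) s t :
  shuffle (xword p (s1 :: s)) (xword p (t1 :: t)) =
    xword p [:: s1] * shuffle (xword p s) (xword p (t1 :: t))
  + xword p [:: t1] * shuffle (xword p (s1 :: s)) (xword p t)
  + xword p [:: pos (s1 + t1)] * shuffle (xword p s) (xword p t)
  + \sum_(1 <= i < s1 + t1)
      let j := (s1 + t1 - i)%N in
      Delta s1 t1 j *:
        (xword p [:: pos i] *
         shuffle (shuffle (xword p s) (xword p t)) (xword p [:: pos j])).
Proof.
rewrite !shuffle_xword.
pose n := (size s + (size t).+1)%N.
have key j : shuffle (shuffle_rec n s t) (xword p [:: j]) =
    bilin (shuffle_rec n) (shuffle_rec n s t) (xword p [:: j]).
  rewrite /shuffle !bilinx; apply: eq_big_seq => v /shuffle_rec_supp v_le.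
  apply: congr1.
  by apply: shuffle_rec_stable; rewrite //= addn1 /n addnS ltnS.
have <- : shuffle_rec n (s1 :: s) t = shuffle_word (s1 :: s) t.
  by apply: shuffle_rec_stable; rewrite /n /= addSn ?addnS.
have <- : shuffle_rec n s t = shuffle_word s t.
  by apply: shuffle_rec_stable; rewrite /n ?addnS.
have <- : shuffle_rec n s (t1 :: t) = shuffle_word s (t1 :: t) by [].
rewrite {1}/shuffle_word [LHS]/=; apply: congr1; apply: eq_bigr => i _.
by apply: congr1; apply: congr1; apply: esym; apply: key.
Qed.

End Shuffle.

Definition gamma_hat (R : realType) (F : finFieldType) (C : Cinfty R F)
    (p N : nat) : shuffle_space p -> C :=
  mmap (fun c : 'F_p => (c : nat)%:R)
    (fun w : {fmonom posint} => gamma C N w).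

(* Main.v *)
(* The truncated sums H_{<d} are multiplicative for the r-shuffle product, for
   each d separately.  Since [a]_u is additive in a, the partial fraction
   expansion of 1 / ([a]^k [b]^l) in terms of [a - b], summed over monic a, b of
   degree d, gives
     H_d(k) H_d(l) = H_d(k + l) + sum_{i + j = k + l} Delta^{i,j} H_d(i) H_{<d}(j),
   the factor Delta coming from sum_{c in F*} c^(-j); combined with
   H_{<d+1}(k w) = H_{<d}(k w) + H_d(k) H_{<d}(w), this yields multiplicativity
   by induction on d.

   To let d tend to infinity one needs the coefficients of H_d(k; u) to tend to
   0.  The coefficient of X^(q^i) in C_a(X) is a polynomial in a, so every
   coefficient of [a]_u^(-k) is a Laurent polynomial in a; nonnegative powers of
   a have vanishing sum over the monic a of large degree d, and negative powers
   have absolute value at most q^(-d).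

   Finally zeta_u is a series in u^(q-1), so the coefficients of u^(N(q-1))
   multiply as in the Cauchy product. *)
From HB Require Import structures.
Require Import Defs.
From mathcomp Require Import all_boot all_order all_fingroup all_solvable.
From mathcomp Require Import all_algebra all_field.
From mathcomp Require Import boolp classical_sets reals finmap monalg ring.

Set Implicit Arguments.
Unset Strict Implicit.
Unset Printing Implicit Defensive.

Import Order.TTheory GRing.Theory Num.Theory.
Local Open Scope ring_scope.

(** * Partial fractions and power sums over polynomials *)

Section PartialFractions.
Variable R : comNzRingType.
Implicit Types x y g : R.

(** With [x], [y], [g] read as 1/X, 1/Y, 1/(X - Y), this is the half of the partial fraction
    expansion of [x ^+ a.+1 * y ^+ b.+1] that involves [x]. The terms with m < b are zero; keeping
    them lets Pascal's rule act termwise. *)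
Definition pfrac (a b : nat) x g : R :=
  \sum_(m < (a + b).+1)
    (-1) ^+ b.+1 * 'C(m, b)%:R * x ^+ (a + b - m).+1 * g ^+ m.+1.

(** Pascal's rule for ['C(m, b)]; the minus sign comes from the factor [(-1) ^+ b.+1]. *)
Lemma pfracSS a b x g :
  pfrac a.+1 b.+1 x g = g * (pfrac a b.+1 x g - pfrac a.+1 b x g).
Proof.
rewrite /pfrac addSn addnS big_ord_recl /= bin0n mulr0 !mul0r add0r.
rewrite !addSn -sumrB big_distrr; apply: eq_bigr => m _ /=.
rewrite /bump add1n subSS binS natrD !exprS.
move: (_ ^+ b) (x ^+ _) (g ^+ m) ('C(m, _)%:R) ('C(m, _)%:R) => *; ring.
Qed.

Lemma pfracS0 a x g : pfrac a.+1 0 x g = g * (pfrac a 0 x g - x ^+ a.+2).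
Proof.
rewrite /pfrac addSn addn0 big_ord_recl /= bin0 subn0 mulrBr big_distrr.
rewrite addrC; congr (_ + _); last first.
  by rewrite !exprS; ring.
apply: eq_bigr => m _ /=; rewrite /bump add1n subSS !bin0 !exprS.
by move: (x ^+ _) (g ^+ m) => *; ring.
Qed.

Lemma pfrac0 b x g : pfrac 0 b x g = x * (- g) ^+ b.+1.
Proof.
rewrite /pfrac add0n big_ord_recr /= binn subnn big1 => [|m _].
  by rewrite add0r mulr1 expr1 [in RHS]exprNn mulrAC mulrC.
by rewrite bin_small ?mulr0 ?mul0r.
Qed.

(** Double induction: the relation lowers one exponent at a time, and [pfrac] obeys the same
    recurrence. The pure powers arising when an exponent reaches 0 are the correction terms of
    [pfracS0]. No inverses are taken, so any commutative ring will do. *)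
Lemma partial_fraction_rec a b x y g : x * y = g * (y - x) ->
  x ^+ a.+1 * y ^+ b.+1 = pfrac a b x g + pfrac b a y (- g).
Proof.
move=> xyE; have stepxy m n : x ^+ m.+1 * y ^+ n.+1 =
    g * (x ^+ m * y ^+ n.+1 - x ^+ m.+1 * y ^+ n).
  by rewrite !exprS mulrACA xyE; ring.
elim: a b => [|a IHa] b.
  elim: b => [|b IHb].
    by rewrite !pfrac0 !expr1 xyE; ring.
  by rewrite stepxy IHb pfracS0 !pfrac0 !exprS; ring.
elim: b => [|b IHb].
  by rewrite stepxy IHa pfracS0 !pfrac0 opprK !exprS; ring.
by rewrite stepxy IHa IHb !pfracSS; ring.
Qed.

Lemma partial_fraction (r s : nat) x y g : (0 < r)%N -> (0 < s)%N ->
  x * y = g * (y - x) ->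
  x ^+ r * y ^+ s = \sum_(1 <= i < r + s)
    ((-1) ^+ s * 'C(r + s - i - 1, s - 1)%:R * x ^+ i * g ^+ (r + s - i)
     + (-1) ^+ r * 'C(r + s - i - 1, r - 1)%:R * y ^+ i
       * (- g) ^+ (r + s - i)).
Proof.
case: r s => [|a] [|b] // _ _ xyE; rewrite (partial_fraction_rec _ _ xyE).
rewrite /pfrac (addnC b) -big_split /= addSn addnS big_add1 big_mkord.
(* The new index is the exponent of [x] (or [y]) instead of that of [g], which reverses the
   order. *)
rewrite (reindex_inj rev_ord_inj) /=; apply: eq_bigr => i _.
have le_i : (i <= a + b)%N by rewrite -ltnS.
by rewrite !subSS !subn0 subKn // subSn // subn1.
Qed.

End PartialFractions.

(** * Sums over all polynomials of bounded degree *)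

Section PolySums.
Variable F : finFieldType.

Lemma npoly_sum_split (V : nmodType) d (phi : {poly F} -> V) :
  \sum_(g : {poly_d.+1 F}) phi g =
  \sum_(c : F) \sum_(g : {poly_d F}) phi (c *: 'X^d + polyn g).
Proof.
have sz (c : F) (g : {poly_d F}) : (size (c *: 'X^d + polyn g)%R <= d.+1)%N.
  rewrite (leq_trans (size_polyD _ _)) // geq_max.
  rewrite (leqW (size_npoly g)) andbT.
  by apply: leq_trans (size_scale_leq _ _) _; rewrite size_polyXn.
rewrite pair_bigA /=.
rewrite (reindex (fun u : F * {poly_d F} =>
   npolyp d.+1 (u.1 *: 'X^d + polyn u.2))) /=; last first.
  exists (fun p : {poly_d.+1 F} => ((polyn p)`_d, npolyp d p)) => [[c g] _|p _].
    rewrite /= npolypK //; congr pair.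
      by rewrite coefD coefZ coefXn eqxx mulr1 nth_default ?addr0 ?size_npoly.
    apply/npolyP => i; rewrite coef_npolyp coefD coefZ coefXn.
    case: ltnP => [lt_id|le_di]; last first.
      by rewrite nth_default ?(leq_trans (size_npoly g)).
    by rewrite ltn_eqF // mulr0 add0r.
  apply/npolyP => i; rewrite coef_npolyp coefD coefZ coefXn coef_npolyp /= ltnS.
  case: (ltngtP i d) => [_|lt_di|->]; rewrite ?mulr0 ?add0r ?mulr1 ?addr0 //.
  by rewrite nth_default // (leq_trans (size_npoly _)).
by apply: eq_bigr => u _; rewrite npolypK.
Qed.

Lemma monic_sum_neq0 d (g : {poly_d F}) : 'X^d + polyn g != 0.
Proof.
apply/eqP => /(congr1 (fun P : {poly F} => P`_d)) /eqP.
rewrite coefD coefXn eqxx coef0 nth_default ?size_npoly //.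
by rewrite addr0 oner_eq0.
Qed.

(** The translation c -> c + 1 permutes F, so adding 1 to every element leaves the total sum
    unchanged. *)
Lemma natr_card : #|F|%:R = 0 :> F.
Proof.
apply: (@addrI _ (\sum_(c : F) c)); rewrite addr0.
rewrite [RHS](reindex_inj (addIr 1)) big_split /=; congr (_ + _).
by rewrite sumr_const cardT.
Qed.

Lemma natr_card_rmorph (K : nzRingType) (kappa : {rmorphism F -> K}) :
  #|F|%:R = 0 :> K.
Proof. by rewrite -(rmorph_nat kappa) natr_card rmorph0. Qed.

Lemma finField_exp_card_pred (c : F) : c != 0 -> c ^+ (#|F| - 1) = 1.
Proof.
move=> c0; apply: (mulfI c0); rewrite -exprS mulr1 subn1 prednK ?expf_card //.
exact: ltnW (finNzRing_gt1 F).
Qed.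

Lemma finField_exp_neq1 j : ~~ (#|F| - 1 %| j)%N ->
  exists2 c : F, c != 0 & c ^+ j != 1.
Proof.
move=> ndvd; have q1 : (0 < #|F| - 1)%N by rewrite subn_gt0 finNzRing_gt1.
apply/exists_inP; apply: contraT => /exists_inPn cj1.
(* If every nonzero c satisfied c^j = 1, then X^k - 1 with 0 < k < q - 1 would have q - 1 roots. *)
pose k := (j %% (#|F| - 1))%N.
have k_gt0 : (0 < k)%N by rewrite lt0n.
have lt_k : (k < #|F| - 1)%N by rewrite ltn_pmod.
have : (size (enum (predC1 (0%R : F))) <= k)%N.
  apply: max_unity_roots => //; last exact: enum_uniq.
  apply/allP => c; rewrite mem_enum => c0.
  have := cj1 c c0; rewrite negbK {1}(divn_eq j (#|F| - 1)) exprD mulnC exprM.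
  by rewrite finField_exp_card_pred // expr1n mul1r unity_rootE.
by rewrite -cardE cardC1 -subn1 leqNgt lt_k.
Qed.

(** The substitution X -> X + t preserves the leading coefficient, so the top terms cancel. *)
Lemma size_comp_shift (K : idomainType) (P : {poly K}) t d :
  (size P <= d.+1)%N -> (size (P \Po ('X + t%:P) - P)%R <= d)%N.
Proof.
move=> szP; have szX : size ('X + t%:P) = 2%N by rewrite size_XaddC.
apply/leq_sizeP => j; rewrite leq_eqVlt coefB => /predU1P[<-|lt_dj].
  have := lead_coef_comp P (q := 'X + t%:P); rewrite szX => /(_ isT).
  rewrite lead_coefXaddC expr1n mulr1 !lead_coefE size_comp_poly2 //.
  move: szP; rewrite leq_eqVlt => /predU1P[-> /= ->|]; first by rewrite subrr.
  by rewrite ltnS => szP _; rewrite !nth_default ?subrr ?size_comp_poly2.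
by rewrite !nth_default ?subrr ?size_comp_poly2 // (leq_trans szP).
Qed.

(** Induction on d: summing over the top coefficient of g replaces P by a polynomial Q of smaller
    degree bound. *)
Lemma npoly_sum_horner0 (K : idomainType) (psi : {additive {poly F} -> K})
    (P : {poly K}) d x : #|F|%:R = 0 :> K -> (size P <= d)%N ->
  \sum_(g : {poly_d F}) P.[x + psi g] = 0.
Proof.
move=> card0; elim: d P => [|d IHd] P szP.
  rewrite big1 // => g _; move: szP; rewrite leqn0 size_poly_eq0 => /eqP->.
  by rewrite horner0.
rewrite (npoly_sum_split d (fun g => P.[x + psi g])) exchange_big /=.
pose Q := \sum_(c : F) (P \Po ('X + (psi (c *: 'X^d))%:P)).
rewrite -[RHS](IHd Q).
  apply: eq_bigr => g _; rewrite /Q horner_sum; apply: eq_bigr => c _.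
  by rewrite horner_comp hornerD hornerX hornerC raddfD /= addrA addrAC.
(* Subtracting P once for each c changes nothing, as [#|F|] is 0 in K, and turns each summand into a
   difference of lower degree. *)
have -> : Q = \sum_(c : F) (P \Po ('X + (psi (c *: 'X^d))%:P) - P).
  by rewrite sumrB sumr_const cardT -cardE -mulr_natr -polyC_natr card0 polyC0
    mulr0 subr0.
by apply: (big_ind (fun S : {poly K} => size S <= d)%N) => [|S T sS sT|c _];
  rewrite ?size_poly0 ?size_comp_shift // (leq_trans (size_polyD _ _)) // geq_max sS.
Qed.

End PolySums.

(** * Products of inverse power sums over monic polynomials *)

Section PowerSums.
Variables (F : finFieldType) (K : comUnitRingType) (kappa : {rmorphism F -> K}).
Variable beta : {additive {poly F} -> K}.
Hypothesis betaZ : forall c f, beta (c *: f) = kappa c * beta f.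
Hypothesis beta_unit : forall f, f != 0 -> beta f \is a GRing.unit.

(** For [beta] the map a -> [a]_u this becomes H_d(s; u). *)
Definition power_sum d s : K :=
  \sum_(g : {poly_d F}) beta ('X^d + polyn g) ^- s.

(** All nonzero polynomials occur, not only monic ones, because these are the differences of two
    distinct monic polynomials of degree d. *)
Definition power_sum_lt d s : K :=
  \sum_(f : {poly_d F} | polyn f != 0) beta f ^- s.

Lemma sum_finField_expV j :
  \sum_(c : F | c != 0) kappa c ^- j = if (#|F| - 1 %| j)%N then -1 else 0.
Proof.
have -> : \sum_(c : F | c != 0) kappa c ^- j =
    kappa (\sum_(c : F | c != 0) c ^- j).
  by rewrite rmorph_sum; apply: eq_bigr => c _; rewrite fmorphV rmorphXn.
case: ifPn => [/dvdnP[k ->]|ndvd].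
  rewrite (eq_bigr (fun=> 1)) => [|c c0]; last first.
    by rewrite mulnC exprM finField_exp_card_pred // expr1n invr1.
  rewrite sumr_const cardC1 -subn1 mulrnBr ?(ltnW (finNzRing_gt1 F)) //.
  by rewrite natr_card sub0r rmorphN1.
have [c0 c0_neq0 c0j] := finField_exp_neq1 ndvd.
suff -> : \sum_(c : F | c != 0) c ^- j = 0 by rewrite rmorph0.
(* Replacing c by [c0 * c] multiplies the sum by [c0 ^- j], which differs from 1. *)
apply/eqP; have : (1 - c0 ^- j) * (\sum_(c : F | c != 0) c ^- j) == 0.
  rewrite mulrBl mul1r subr_eq0 big_distrr /=; apply/eqP.
  rewrite [LHS](reindex_inj (mulfI c0_neq0)).
  apply: eq_big => [c|c _]; first by rewrite mulf_eq0 (negPf c0_neq0).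
  by rewrite exprMn invfM.
by rewrite mulf_eq0 subr_eq0 eq_sym invr_eq1 (negPf c0j).
Qed.

Lemma power_sum_ltS d s : power_sum_lt d.+1 s =
  power_sum_lt d s + (\sum_(c : F | c != 0) kappa c ^- s) * power_sum d s.
Proof.
rewrite /power_sum_lt big_mkcond.
rewrite (npoly_sum_split d (fun f => if f != 0 then beta f ^- s else 0)) /=.
rewrite (bigD1 0) //= [in RHS]big_mkcond; congr (_ + _).
  by apply: eq_bigr => g _; rewrite scale0r add0r.
rewrite big_distrl; apply: eq_bigr => c c0 /=.
(* Rescaling g by c makes the top coefficient c a common factor. *)
rewrite (reindex_inj (scalerI c0)) /power_sum big_distrr; apply: eq_bigr => g _.
have cXg : c *: 'X^d + polyn (c *: g) = c *: ('X^d + polyn g).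
  by rewrite scalerDr.
rewrite cXg scaler_eq0 (negPf c0) monic_sum_neq0 betaZ exprMn.
rewrite invrM ?unitrX ?beta_unit ?monic_sum_neq0 //; first by rewrite mulrC.
by rewrite rmorph_unit // unitfE.
Qed.

(** The diagonal gives [power_sum d (r + s)]. Off the diagonal, partial fractions apply with g = 1 /
    beta(difference); for one polynomial fixed, the difference runs over all nonzero polynomials of
    degree < d. *)
Lemma power_sumM d r s : (0 < r)%N -> (0 < s)%N ->
  power_sum d r * power_sum d s = power_sum d (r + s) +
  \sum_(1 <= i < r + s)
    ((-1) ^+ s * 'C(r + s - i - 1, s - 1)%:R
     + (-1) ^+ r * 'C(r + s - i - 1, r - 1)%:R)
    * (power_sum d i * power_sum_lt d (r + s - i)).
Proof.
move=> r_gt0 s_gt0; pose x (g : {poly_d F}) := (beta ('X^d + polyn g))^-1.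
pose y (g h : {poly_d F}) := (beta (polyn (g - h)))^-1.
have xE n : power_sum d n = \sum_g x g ^+ n.
  by apply: eq_bigr => g _; rewrite exprVn.
have x_unit (g : {poly_d F}) : beta ('X^d + polyn g) \is a GRing.unit.
  exact/beta_unit/monic_sum_neq0.
have y_sum (g : {poly_d F}) n :
    \sum_(h | h != g) y g h ^+ n = power_sum_lt d n.
  rewrite (reindex_inj (subrI g)); apply: eq_big => [f|f _].
    by rewrite -subr_eq0 addrAC subrr add0r oppr_eq0 -val_eqE.
  by rewrite /y subKr exprVn.
have yN (g h : {poly_d F}) : - y g h = y h g.
  have -> : y h g = (beta (- polyn (g - h)))^-1 by rewrite -raddfN opprB.
  by rewrite raddfN invrN.
have xy (g h : {poly_d F}) : h != g -> x g * x h = y g h * (x h - x g).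
  move=> neq_hg; have gh_unit : beta (polyn (g - h)) \is a GRing.unit.
    by rewrite beta_unit // (inj_eq val_inj (g - h) 0) subr_eq0 eq_sym.
  apply: (mulrI gh_unit); rewrite /y mulVKr //.
  have -> : polyn (g - h) = ('X^d + polyn g) - ('X^d + polyn h).
    by rewrite raddfB opprD addrACA subrr add0r.
  by rewrite raddfB mulrBl mulrA divrr // mul1r mulrCA divrr // mulr1.
rewrite !xE big_distrlr /=.
have -> : \sum_g \sum_h x g ^+ r * x h ^+ s = \sum_g x g ^+ (r + s)
    + \sum_g \sum_(h | h != g) x g ^+ r * x h ^+ s.
  by rewrite -big_split; apply: eq_bigr => g _; rewrite (bigD1 g) //= exprD.
congr (_ + _).
pose A i : K := (-1) ^+ s * 'C(r + s - i - 1, s - 1)%:R.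
pose B i : K := (-1) ^+ r * 'C(r + s - i - 1, r - 1)%:R.
transitivity (\sum_(1 <= i < r + s) \sum_g \sum_(h | h != g)
  (A i * x g ^+ i * y g h ^+ (r + s - i)
   + B i * x h ^+ i * y h g ^+ (r + s - i))).
  rewrite [RHS]exchange_big /=; apply: eq_bigr => g _.
  rewrite [RHS]exchange_big /=; apply: eq_bigr => h neq_hg.
  by rewrite (partial_fraction r_gt0 s_gt0 (xy g h neq_hg)) yN.
apply: eq_bigr => i _; under eq_bigr => g _ do rewrite big_split /=.
rewrite big_split mulrDl; congr (_ + _).
  rewrite xE big_distrl big_distrr; apply: eq_bigr => g _ /=.
  by rewrite -(y_sum g) mulrA big_distrr.
(* The second half is the first with the two monic polynomials interchanged; the sign of the
   difference was absorbed by [yN]. *)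
rewrite (exchange_big_dep predT) //= xE big_distrl big_distrr.
apply: eq_bigr => h _ /=; rewrite -(y_sum h) mulrA big_distrr.
by apply: eq_big => [g|g _]; rewrite // eq_sym.
Qed.

End PowerSums.

(** * The embedding of A and the coefficients of the Carlitz module *)

Section FpsTheory.
Variable K : fieldType.
Implicit Types f g : fps K.

Lemma fps_unitE f : (f \is a GRing.unit) = (fcoef f 0 != 0).
Proof. by []. Qed.

Lemma fcoef_sum I (r : seq I) (P : pred I) (f : I -> fps K) n :
  fcoef (\sum_(i <- r | P i) f i) n = \sum_(i <- r | P i) fcoef (f i) n.
Proof. by apply: (big_morph (fun f => fcoef f n)). Qed.

Definition fps_const (c : K) : fps K := fps_of_poly c%:P.

Lemma fcoef_constM c f n : fcoef (fps_const c * f) n = c * fcoef f n.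
Proof.
rewrite fcoefM big_ord_recl subn0 /= coefC eqxx big1 ?addr0 // => i _.
by rewrite coefC mul0r.
Qed.

Fact fps_const_zmod_morphism : zmod_morphism fps_const.
Proof. by move=> x y; apply/fpsP => n; rewrite /= rmorphB /= coefB. Qed.

Fact fps_const_monoid_morphism : monoid_morphism fps_const.
Proof.
split=> [|x y]; apply/fpsP => n; first by rewrite /= coef1.
by rewrite fcoef_constM /= !coefC; case: eqP; rewrite ?mulr0.
Qed.

HB.instance Definition _ :=
  GRing.isZmodMorphism.Build K (fps K) fps_const fps_const_zmod_morphism.
HB.instance Definition _ :=
  GRing.isMonoidMorphism.Build K (fps K) fps_const fps_const_monoid_morphism.

End FpsTheory.

Section Embedding.
Variables (R : realType) (F : finFieldType).

Lemma A_to_KinftyE (a : {poly F}) : A_to_Kinfty a =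
  (map_poly (@tofrac (fps F) \o @fps_const F) a).[(tofrac (invtheta F))^-1].
Proof. by []. Qed.

Fact A_to_Kinfty_zmod_morphism : zmod_morphism (@A_to_Kinfty F).
Proof. by move=> a b; rewrite !A_to_KinftyE rmorphB hornerD hornerN. Qed.

Fact A_to_Kinfty_monoid_morphism : monoid_morphism (@A_to_Kinfty F).
Proof.
by split=> [|a b]; rewrite !A_to_KinftyE ?rmorph1 ?hornerC // rmorphM hornerM.
Qed.

HB.instance Definition _ := GRing.isZmodMorphism.Build {poly F} (Kinfty F)
  (@A_to_Kinfty F) A_to_Kinfty_zmod_morphism.
HB.instance Definition _ := GRing.isMonoidMorphism.Build {poly F} (Kinfty F)
  (@A_to_Kinfty F) A_to_Kinfty_monoid_morphism.

Variable C : Cinfty R F.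

Fact iota_A_zmod_morphism : zmod_morphism (iota_A C).
Proof. by move=> a b; rewrite /iota_A !rmorphB. Qed.

Fact iota_A_monoid_morphism : monoid_morphism (iota_A C).
Proof. by split=> [|a b]; rewrite /iota_A ?rmorph1 // !rmorphM. Qed.

HB.instance Definition _ :=
  GRing.isZmodMorphism.Build {poly F} C (iota_A C) iota_A_zmod_morphism.
HB.instance Definition _ :=
  GRing.isMonoidMorphism.Build {poly F} C (iota_A C) iota_A_monoid_morphism.

Let deg (a : {poly F}) := (size a).-1.

(* Multiplying by theta^(- deg a) turns a into a unit of F[[1/theta]]. *)
Lemma A_to_Kinfty_unit (a : {poly F}) : a != 0 ->
  exists2 u : fps F, u \is a GRing.unit &
    A_to_Kinfty a * tofrac (invtheta F) ^+ deg a = tofrac u.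
Proof.
move=> a0; have szE : size a = (deg a).+1 by rewrite prednK ?lt0n ?size_poly_eq0.
have t0 : tofrac (invtheta F) != 0.
  by rewrite tofrac_eq0; apply/eqP => /fpsP /(_ 1%N) /eqP; rewrite /= coefX oner_eq0.
exists (\sum_(i < (deg a).+1) fps_const a`_i * invtheta F ^+ (deg a - i)).
  rewrite fps_unitE fcoef_sum big_ord_recr big1 => [|i _].
    rewrite fcoef_constM (subnn (deg a)) expr0 /= mulr1 add0r.
    by rewrite -lead_coefE lead_coef_eq0.
  rewrite fcoef_constM (_ : deg a - i = (deg a - i).-1.+1)%N; last first.
    by rewrite prednK // subn_gt0.
  by rewrite exprS fcoefM big_ord1 /= coefX mul0r mulr0.
rewrite A_to_KinftyE horner_coef size_map_poly szE big_distrl rmorph_sum.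
apply: eq_bigr => i _; rewrite coef_map rmorphM rmorphXn /= -mulrA; congr (_ * _).
have le_i : (i <= deg a)%N by rewrite -ltnS.
apply: (mulIf (expf_neq0 i t0)).
by rewrite -exprD subnK // mulrAC -exprMn mulVf // expr1n mul1r.
Qed.

Lemma iota_A_eq0 (a : {poly F}) : (iota_A C a == 0) = (a == 0).
Proof.
apply/idP/idP => [|/eqP->]; last by rewrite rmorph0.
rewrite /iota_A !fmorph_eq0; apply: contraTT => a0.
have [u u1 au] := A_to_Kinfty_unit a0; apply/eqP => a_eq0.
have: tofrac u != 0 by rewrite tofrac_eq0; apply: contraTneq u1 => ->; rewrite unitr0.
by rewrite -au a_eq0 mul0r eqxx.
Qed.

Lemma cabs1 : cabs (1 : C) = 1.
Proof.
have := @cabs_unit _ _ C 1 (unitr1 _).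
by rewrite !rmorph1.
Qed.

Lemma cabsX (x : C) n : cabs (x ^+ n) = cabs x ^+ n.
Proof. by elim: n => [|n IHn]; rewrite ?cabs1 // !exprS cabsM IHn. Qed.

Lemma cabs_iota_A (a : {poly F}) : a != 0 ->
  cabs (iota_A C a) = #|F|%:R ^+ deg a.
Proof.
move=> a0; have [u u1 au] := A_to_Kinfty_unit a0.
have := cabs_unit C u1; rewrite -au !rmorphM !rmorphXn /= cabsM cabsX.
rewrite cabs_invtheta exprVn => /divr1_eq //.
Qed.

End Embedding.

(** * Coefficients of the Carlitz module as additive polynomials *)

Section Carlitz.
Variables (R : realType) (F : finFieldType) (C : Cinfty R F).
Let q := #|F|.
Let theta : C := iota_A C 'X.
Let kappa (c : F) : C := iota_A C c%:P.

(** The additive group of F is elementary abelian, so q is a power of the characteristic; this makes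
    x -> x^q additive. *)
Lemma cardF_pcharnat (K : nzRingType) (h : {rmorphism F -> K}) : [pchar K].-nat q.
Proof.
have [p _ pF] := finPcharP F.
have : p.-nat q.
  by rewrite /q -cardsT -pgroupE (abelem_pgroup (fin_ring_pchar_abelem pF)).
apply: sub_in_pnat => x _; rewrite !inE => /eqP->.
exact: (rmorph_pchar h pF).
Qed.

Lemma expn_cardF_eq1 i : (q ^ i == 1)%N = (i == 0)%N.
Proof. by rewrite -{1}(expn0 q) eqn_exp2l // finNzRing_gt1. Qed.

Lemma exprD_cardF (x y : C) : (x + y) ^+ q = x ^+ q + y ^+ q.
Proof.
exact: exprDn_pchar (cardF_pcharnat (iota_A C \o polyC)).
Qed.

Lemma exprB_cardF (x y : C) : (x - y) ^+ q = x ^+ q - y ^+ q.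
Proof. by apply: (addIr (y ^+ q)); rewrite -exprD_cardF !subrK. Qed.

Lemma theta_Frobenius_neq i : theta ^+ (q ^ i.+1) - theta != 0.
Proof.
rewrite -rmorphXn -rmorphB iota_A_eq0 subr_eq0; apply/eqP.
move=> /(congr1 (fun a => size (a : {poly F}))).
rewrite size_polyXn size_polyX => -[] /eqP.
by rewrite expn_cardF_eq1.
Qed.

(* The coefficient of X^(q^i) in C_a(X) is the value at a of this polynomial;
   the recursion comes from C_(theta a) = C_theta o C_a = C_a o C_theta. *)
Fixpoint carlitz_coef i : {poly C} :=
  if i is j.+1 then
    (theta ^+ (q ^ j.+1) - theta)^-1 *: (carlitz_coef j ^+ q - carlitz_coef j)
  else 'X.

Let ev i (x : C) := (carlitz_coef i).[x].

Lemma carlitz_coef_rec i x : ev i x ^+ q - ev i x =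
  (theta ^+ (q ^ i.+1) - theta) * ev i.+1 x.
Proof.
rewrite {3}/ev /= hornerZ hornerD hornerN horner_exp mulrA divff ?mul1r //.
exact: theta_Frobenius_neq.
Qed.

Lemma carlitz_coefS i x : ev i.+1 x =
  (theta ^+ (q ^ i.+1) - theta)^-1 * (ev i x ^+ q - ev i x).
Proof. by rewrite carlitz_coef_rec mulKf ?theta_Frobenius_neq. Qed.

Lemma carlitz_coefD i x y :
  (carlitz_coef i).[x + y] = (carlitz_coef i).[x] + (carlitz_coef i).[y].
Proof.
elim: i => [|i IHi]; first by rewrite !hornerX.
rewrite -!/(ev _ _) !carlitz_coefS /ev IHi exprD_cardF -mulrDr.
by rewrite opprD addrACA.
Qed.

Lemma kappaXq c : kappa c ^+ q = kappa c.
Proof. by rewrite /kappa -!rmorphXn expf_card. Qed.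

Lemma carlitz_coefZ i c x :
  (carlitz_coef i).[iota_A C c%:P * x] = iota_A C c%:P * (carlitz_coef i).[x].
Proof.
elim: i => [|i IHi]; first by rewrite !hornerX.
rewrite -!/(ev _ _) !carlitz_coefS /ev IHi exprMn -/(kappa c) kappaXq.
by rewrite -mulrBr mulrCA.
Qed.

(** Coefficient form of C_(theta a) = C_theta o C_a. The defining recursion encodes agreement with
    C_a o C_theta, and is used to carry the induction on i. *)
Lemma carlitz_coef_theta i x : ev i.+1 (theta * x) = theta * ev i.+1 x + ev i x ^+ q.
Proof.
elim: i => [|i IHi].
  apply: (mulfI (theta_Frobenius_neq 0)); rewrite -carlitz_coef_rec /ev !hornerX.
  rewrite mulrDr mulrCA -carlitz_coef_rec /ev !hornerX expn1 exprMn.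
  by move: (x ^+ q) (theta ^+ q) => *; ring.
apply: (mulfI (theta_Frobenius_neq i.+1)); rewrite -carlitz_coef_rec IHi.
rewrite mulrDr mulrCA -carlitz_coef_rec exprD_cardF exprMn.
(* This is the q-th power of the recursion at i. *)
have -> : ev i x ^+ q ^+ q = (theta ^+ (q ^ i.+2) - theta ^+ q) * ev i.+1 x ^+ q
    + ev i x ^+ q.
  have <- : (theta ^+ (q ^ i.+1) - theta) ^+ q = theta ^+ (q ^ i.+2) - theta ^+ q.
    by rewrite exprB_cardF -exprM -expnSr.
  by rewrite -exprMn -carlitz_coef_rec exprB_cardF subrK.
move: (theta ^+ _) (theta ^+ q) (ev i x ^+ q) (ev i.+1 x) (ev i.+1 x ^+ q).
by move=> *; ring.
Qed.

(** C_(theta^k) has no term beyond X^(q^k). *)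
Lemma carlitz_coef_thetaX i k : (k < i)%N -> ev i (theta ^+ k) = 0.
Proof.
elim: k i => [|k IHk] [|i] //; last first.
  rewrite ltnS => lt_ki; rewrite exprS carlitz_coef_theta !IHk ?leqW //.
  by rewrite mulr0 add0r expr0n /q gtn_eqF // (ltnW (finNzRing_gt1 F)).
move=> _; elim: i => [|i IHi]; rewrite carlitz_coefS.
  by rewrite /ev hornerX expr1n subrr mulr0.
by rewrite IHi expr0n /q gtn_eqF ?subrr ?mulr0 // (ltnW (finNzRing_gt1 F)).
Qed.

(** Any cut-off M >= k is allowed, so that all the C_(theta^k) entering C_a share one range of
    summation. *)
Lemma iter_carlitz_theta M k : (k <= M)%N ->
  map_poly (iota_A C) (iter k (fun P => carlitz_theta F \Po P) 'X) =
  \sum_(i < M.+1) ev i (theta ^+ k) *: 'X^(q ^ i).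
Proof.
elim: k => [_|k IHk lt_kM].
  rewrite /= map_polyX big_ord_recl expr0 /ev hornerX scale1r big1 ?addr0 // => i _.
  by rewrite -/(ev _ _) (carlitz_coef_thetaX (k := 0)) // scale0r.
rewrite iterS /carlitz_theta rmorphD /= rmorphM /= comp_polyC comp_polyX comp_Xn_poly.
rewrite rmorphD rmorphM rmorphXn /= map_polyC /= IHk; last exact: ltnW.
rewrite -/theta.
have FrobD (P Q : {poly C}) : (P + Q) ^+ q = P ^+ q + Q ^+ q.
  exact: exprDn_pchar (cardF_pcharnat (polyC \o (iota_A C \o polyC))).
have -> : (\sum_(i < M.+1) ev i (theta ^+ k) *: 'X^(q ^ i)) ^+ q =
    \sum_(i < M.+1) ev i (theta ^+ k) ^+ q *: 'X^(q ^ i.+1).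
  rewrite (big_morph (fun P : {poly C} => P ^+ q) FrobD (id1 := 0)).
    by apply: eq_bigr => i _; rewrite exprZn -exprM -expnSr.
  by rewrite expr0n /q gtn_eqF // (ltnW (finNzRing_gt1 F)).
(* Since k < M, the top term of the Frobenius part is zero and the shifted sum stays within
   range. *)
rewrite [X in _ + X]big_ord_recr /= carlitz_coef_thetaX // expr0n.
rewrite [(q == 0)%N]gtn_eqF ?(ltnW (finNzRing_gt1 F)) // scale0r addr0.
rewrite big_distrr [in RHS]big_ord_recl [in LHS]big_ord_recl -addrA -big_split /=.
congr (_ + _).
  by rewrite mul_polyC scalerA /ev !hornerX exprS.
apply: eq_bigr => i _.
by rewrite mul_polyC scalerA exprS carlitz_coef_theta scalerDl.
Qed.

Lemma map_carlitz M (a : {poly F}) : (size a <= M.+1)%N ->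
  map_poly (iota_A C) (carlitz a) =
  \sum_(i < M.+1) (carlitz_coef i).[iota_A C a] *: 'X^(q ^ i).
Proof.
move=> sz_a; rewrite /carlitz rmorph_sum /=.
transitivity (\sum_(k < size a) \sum_(i < M.+1)
    (kappa a`_k * ev i (theta ^+ k)) *: ('X^(q ^ i) : {poly C})).
  apply: eq_bigr => k _; rewrite map_polyZ /= (@iter_carlitz_theta M); last first.
    by rewrite -ltnS (leq_trans _ sz_a).
  by rewrite scaler_sumr; apply: eq_bigr => i _; rewrite scalerA.
rewrite exchange_big /=; apply: eq_bigr => i _; rewrite -scaler_suml; congr (_ *: _).
rewrite -[in RHS](coefK a) poly_def rmorph_sum /=.
have ev0 : (carlitz_coef i).[0] = 0.
  by apply: (addrI (carlitz_coef i).[0]); rewrite -carlitz_coefD !addr0.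
rewrite (big_morph _ (carlitz_coefD i) ev0); apply: eq_bigr => k _.
by rewrite -mul_polyC rmorphM /= rmorphXn carlitz_coefZ.
Qed.

(** At most one term: the i with q^i = n + 1, the shift by one coming from the division by u. The
    bound is harmless since i < q^i. *)
Definition bracket_coef n : {poly C} :=
  \sum_(i < n.+2 | (q ^ i == n.+1)%N) carlitz_coef i.

Lemma fcoef_bracket n (a : {poly F}) :
  fcoef (bracket_fps C a) n = (bracket_coef n).[iota_A C a].
Proof.
rewrite /bracket_fps /= /bracket coef_map coef_drop_poly addn1 -coef_map.
pose M := (size a + n.+1)%N; rewrite (@map_carlitz M); last first.
  by rewrite leqW // leq_addr.
have le_nM : (n.+2 <= M.+1)%N by rewrite ltnS leq_addl.
rewrite coef_sum horner_sum (big_ord_widen_cond _ (fun i => q ^ i == n.+1)%N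
  (fun i => (carlitz_coef i).[iota_A C a]) le_nM) [RHS]big_mkcond.
apply: eq_bigr => i _; rewrite coefZ coefXn [(n.+1 == _)]eq_sym.
case: eqP => [qi|_]; last by rewrite mulr0.
by rewrite -qi ltnW ?ltnS ?mulr1 // ltn_expl // finNzRing_gt1.
Qed.

Lemma fcoef_bracket0 (a : {poly F}) : fcoef (bracket_fps C a) 0 = iota_A C a.
Proof.
rewrite fcoef_bracket /bracket_coef (bigD1 ord0) //= big1 => [|i].
  by rewrite addr0 hornerX.
rewrite expn_cardF_eq1 => /andP[/eqP i0] /eqP[].
exact: val_inj.
Qed.

(** The exponents of [a]_u are the q^i - 1, all divisible by q - 1. *)
Lemma fcoef_bracket_eq0 n (a : {poly F}) : ~~ (q - 1 %| n)%N ->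
  fcoef (bracket_fps C a) n = 0.
Proof.
move=> ndvd; rewrite fcoef_bracket /bracket_coef big1 ?horner0 // => i /eqP qi.
case/negP: ndvd; rewrite -[n]/(n.+1.-1) -qi predn_exp subn1.
exact: dvdn_mulr.
Qed.

Lemma bracket_coefD n x y :
  (bracket_coef n).[x + y] = (bracket_coef n).[x] + (bracket_coef n).[y].
Proof.
rewrite !horner_sum -big_split; apply: eq_bigr => i _.
by rewrite carlitz_coefD.
Qed.

Fact bracket_fps_zmod_morphism : zmod_morphism (bracket_fps C).
Proof.
have bracketD a b : bracket_fps C (a + b) = bracket_fps C a + bracket_fps C b.
  apply/fpsP => n.
  by rewrite fcoefD !fcoef_bracket -bracket_coefD -rmorphD.
by move=> a b; apply: (addIr (bracket_fps C b)); rewrite subrK -bracketD subrK.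
Qed.

HB.instance Definition _ := GRing.isZmodMorphism.Build {poly F} (fps C)
  (bracket_fps C) bracket_fps_zmod_morphism.

Lemma bracket_fpsZ c (a : {poly F}) :
  bracket_fps C (c *: a) = fps_const (iota_A C c%:P) * bracket_fps C a.
Proof.
apply/fpsP => n; rewrite fcoef_constM !fcoef_bracket -mul_polyC rmorphM.
rewrite !horner_sum big_distrr; apply: eq_bigr => i _.
by rewrite carlitz_coefZ.
Qed.

Lemma bracket_fps_unit (a : {poly F}) :
  a != 0 -> bracket_fps C a \is a GRing.unit.
Proof. by move=> a0; rewrite fps_unitE fcoef_bracket0 iota_A_eq0. Qed.

End Carlitz.

(** * Multiplicativity of the truncated sums *)

Section NestedSums.
Variables (K : comNzRingType) (H : nat -> posint -> K).

(** The ambient type ['I_D] stays fixed while the bound n on the largest index shrinks, as the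
    induction on s requires. *)
Let nested D n (s : Index) : K :=
  \sum_(k : (size s).-tuple 'I_D | path gtn n [seq val i | i <- k])
    \prod_(j < size s) H (tnth k j) (tnth (in_tuple s) j).

Fixpoint nested_rec n (s : Index) : K :=
  if s is s1 :: s' then \sum_(i < n) H i s1 * nested_rec i s' else 1.

Lemma nested_sumE D (s : Index) :
  \sum_(k : (size s).-tuple 'I_D | sorted gtn [seq val i | i <- k])
    \prod_(j < size s) H (tnth k j) (tnth (in_tuple s) j) = nested_rec D s.
Proof.
transitivity (nested D D s).
  by apply: eq_bigl => k; case: (tval k) => //= i l; rewrite ltn_ord.
have: (D <= D)%N by []. move: {1 4 5}D; elim: s => [|s1 s IHs] n le_nD.
  rewrite /nested (big_pred1 [tuple]) => [|k]; first by rewrite big_ord0.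
  by rewrite (tuple0 k); apply/esym/eqP.
rewrite /nested (reindex (fun u : 'I_D * (size s).-tuple 'I_D =>
   [tuple of u.1 :: u.2])) /=; last first.
  exists (fun k : (size s).+1.-tuple 'I_D => (thead k, [tuple of behead k])).
    by move=> [i k] _; congr pair; apply: val_inj.
  by move=> k _; rewrite /= -tuple_eta.
transitivity (\sum_(i < D | (i < n)%N) H i s1 * nested_rec i s).
  rewrite -(pair_big_dep (fun i : 'I_D => (i < n)%N)
     (fun (i : 'I_D) (k : (size s).-tuple 'I_D) => path gtn i [seq val j | j <- k])
     (fun i k => \prod_(j < (size s).+1)
        H (tnth [tuple of i :: k] j) (tnth (in_tuple (s1 :: s)) j))) /=.
  apply: eq_bigr => i lt_in; rewrite -IHs; last by rewrite ltnW.
  rewrite big_distrr; apply: eq_bigr => k _ /=.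
  rewrite big_ord_recl; congr (_ * _); apply: eq_bigr => j _.
  by rewrite !(tnth_nth i) !(tnth_nth s1).
rewrite -(big_ord_widen_cond D (fun=> true) (fun i => H i s1 * nested_rec i s)) //.
Qed.

End NestedSums.

Section TruncatedSums.
Variables (R : realType) (F : finFieldType) (C : Cinfty R F).
Implicit Types (s t : Index) (k : posint).

Lemma Hd_power_sum d k : Hd C d k = power_sum (bracket_fps C) d k.
Proof.
rewrite /Hd big_mkcond /=.
rewrite (npoly_sum_split d (fun a : {poly F} =>
  if (a \is monic) && (size a == d.+1) then bracket_fps C a ^- k else 0)) /=.
have coefd (c : F) (g : {poly_d F}) : (c *: 'X^d + polyn g)`_d = c.
  by rewrite coefD coefZ coefXn eqxx mulr1 nth_default ?addr0 ?size_npoly.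
(* Only the top coefficient c = 1 is compatible with being monic of degree d. *)
rewrite (bigD1 1) //= [X in _ + X]big1 ?addr0 => [|c c1].
  apply: eq_bigr => g _; rewrite scale1r.
  have szg : (size (polyn g) < size ('X^d : {poly F}))%N.
    by rewrite size_polyXn ltnS size_npoly.
  by rewrite monicE lead_coefDl // lead_coefXn eqxx size_polyDl // size_polyXn eqxx.
apply: big1 => g _; case: ifP => // /andP[/monicP + /eqP szE].
by rewrite lead_coefE szE coefd => c_eq1; rewrite c_eq1 eqxx in c1.
Qed.

Lemma Hlt_rec d s : Hlt C d s = nested_rec (Hd C) d s.
Proof. exact: nested_sumE. Qed.

Lemma Hlt0 d : Hlt C d [::] = 1.
Proof. by rewrite Hlt_rec. Qed.

Lemma Hlt_cons0 k s : Hlt C 0 (k :: s) = 0.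
Proof. by rewrite Hlt_rec /= big_ord0. Qed.

Lemma HltS d k s :
  Hlt C d.+1 (k :: s) = Hlt C d (k :: s) + Hd C d k * Hlt C d s.
Proof. by rewrite !Hlt_rec /= big_ord_recr. Qed.

Lemma posK n : (0 < n)%N -> posval (pos n) = n.
Proof. by move=> n_gt0; rewrite /pos insubdK. Qed.

(** Each nonzero polynomial is c times a monic one; the sum of c^(-k) over c splits off and equals
    -1 or 0. *)
Lemma power_sum_lt_Hlt d k : power_sum_lt (bracket_fps C) d k =
  (if (#|F| - 1 %| k)%N then -1 else 0) * Hlt C d [:: k].
Proof.
elim: d => [|d IHd].
  rewrite Hlt_cons0 mulr0 /power_sum_lt big_pred0 // => g.
  by have := size_npoly g; rewrite leqn0 size_poly_eq0 => ->.
have kb (c : F) (f : {poly F}) : bracket_fps C (c *: f) =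
    (@fps_const C \o (iota_A C \o polyC)) c * bracket_fps C f.
  exact: bracket_fpsZ.
rewrite (power_sum_ltS kb (@bracket_fps_unit _ _ C)) IHd sum_finField_expV.
by rewrite HltS Hlt0 mulr1 Hd_power_sum mulrDr.
Qed.

End TruncatedSums.

(** * Linear extension of functions on words *)

Section LinearExtension.
Variables (p : nat) (K : comNzRingType) (f : {rmorphism 'F_p -> K}).
Implicit Types (h : Index -> K) (g : shuffle_space p).

Definition lin_ext h g : K := mmap f (fun w : {fmonom posint} => h w) g.

Fact lin_ext_zmod_morphism h : zmod_morphism (lin_ext h).
Proof. exact: mmapB. Qed.

HB.instance Definition _ h := GRing.isZmodMorphism.Build (shuffle_space p) K
  (lin_ext h) (lin_ext_zmod_morphism h).

Lemma lin_extZ h c g : lin_ext h (c *: g) = f c * lin_ext h g.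
Proof.
rewrite /lin_ext (mmapEw (msuppZ_le _ _)) mmapE big_distrr /=.
by apply: eq_bigr => w _; rewrite mcoeffZ rmorphM mulrA.
Qed.

Lemma lin_ext_xword h s : lin_ext h (xword p s) = h s.
Proof. by rewrite /lin_ext /xword mmapU /= rmorph1 mul1r. Qed.

Lemma xword_expand g : g = \sum_(w <- msupp g) g@_w *: xword p w.
Proof.
rewrite {1}(monalgE g); apply: eq_bigr => -[w] _; apply/malgP => v.
rewrite mcoeffZ [LHS]mcoeffU [X in _ = _ * X]mcoeffU.
by rewrite mulr_natr.
Qed.

Lemma shuffle_space_scaleAr (c : 'F_p) (g1 g2 : shuffle_space p) :
  g1 * (c *: g2) = c *: (g1 * g2).
Proof. by rewrite -[c]natr_Zp !scaler_nat mulrnAr. Qed.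

Lemma lin_extD h g1 g2 : lin_ext h (g1 + g2) = lin_ext h g1 + lin_ext h g2.
Proof. exact: raddfD. Qed.

Lemma lin_ext_sum h I (r : seq I) (g : I -> shuffle_space p) :
  lin_ext h (\sum_(i <- r) g i) = \sum_(i <- r) lin_ext h (g i).
Proof. exact: raddf_sum. Qed.

Section Cons.
Variables (h h1 : Index -> K) (a : K) (c : posint -> K).
Hypothesis h_cons : forall k w, h (k :: w) = a * h1 (k :: w) + c k * h1 w.

(** The hypothesis [h_cons] has the shape of the recursion for H_{<d+1} on words; it is linear in
    the tail, hence passes to combinations of tails. *)
Lemma lin_ext_cons k g :
  lin_ext h (xword p [:: k] * g) =
    a * lin_ext h1 (xword p [:: k] * g) + c k * lin_ext h1 g.
Proof.
have consE (w : Index) b :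
    xword p [:: k] * (b *: xword p w) = b *: xword p (k :: w).
  by rewrite shuffle_space_scaleAr; congr (_ *: _); exact: esym (xword_cat p [:: k] w).
have term u (w : Index) b : lin_ext u (xword p [:: k] * (b *: xword p w)) = f b * u (k :: w).
  transitivity (lin_ext u (b *: xword p (k :: w))).
    by have := congr1 (lin_ext u) (consE w b).
  by rewrite lin_extZ lin_ext_xword.
have expand u : lin_ext u (xword p [:: k] * g) =
    \sum_(w <- msupp g) f g@_w * u (k :: w).
  transitivity (lin_ext u (\sum_(w <- msupp g) xword p [:: k] * (g@_w *: xword p w))).
    by apply: congr1; rewrite {1}(xword_expand g); apply: big_distrr.
  by rewrite lin_ext_sum; apply: eq_bigr => w _; apply: term.
rewrite (expand h) (expand h1) [lin_ext h1 g]mmapE 2!big_distrr -big_split.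
apply: eq_bigr => w _ /=; rewrite h_cons mulrDr mulrCA; congr (_ + _).
exact: mulrCA.
Qed.

(* The right-hand side of the recursion defining the shuffle of two words, for
   arbitrary tails. *)
Lemma lin_ext_cons_sum k l m n D (ks : nat -> posint) g1 g2 g3 gs :
  let g := xword p [:: k] * g1 + xword p [:: l] * g2 + xword p [:: m] * g3
    + \sum_(1 <= i < n) D i *: (xword p [:: ks i] * gs i) in
  lin_ext h g = a * lin_ext h1 g +
    (c k * lin_ext h1 g1 + c l * lin_ext h1 g2 + c m * lin_ext h1 g3
     + \sum_(1 <= i < n) f (D i) * (c (ks i) * lin_ext h1 (gs i))).
Proof.
suff ext4 (u : posint -> shuffle_space p -> shuffle_space p) :
    (forall k g, lin_ext h (u k g) = a * lin_ext h1 (u k g) + c k * lin_ext h1 g) ->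
    let g := u k g1 + u l g2 + u m g3 + \sum_(1 <= i < n) D i *: u (ks i) (gs i) in
    lin_ext h g = a * lin_ext h1 g +
    (c k * lin_ext h1 g1 + c l * lin_ext h1 g2 + c m * lin_ext h1 g3
     + \sum_(1 <= i < n) f (D i) * (c (ks i) * lin_ext h1 (gs i))).
  exact: (ext4 (fun k g => xword p [:: k] * g) lin_ext_cons).
move=> uE; rewrite /= !lin_extD !lin_ext_sum !uE.
have -> : \sum_(1 <= i < n) lin_ext h (D i *: u (ks i) (gs i)) =
    a * \sum_(1 <= i < n) lin_ext h1 (D i *: u (ks i) (gs i))
    + \sum_(1 <= i < n) f (D i) * (c (ks i) * lin_ext h1 (gs i)).
  rewrite big_distrr -big_split; apply: eq_bigr => i _ /=.
  by rewrite !lin_extZ uE mulrDr mulrCA.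
move: (\sum_(1 <= i < n) _) (\sum_(1 <= i < n) _) => S1 S2.
move: (lin_ext h1 (u _ _)) (lin_ext h1 (u _ _)) (lin_ext h1 (u _ _)) => x y z.
by ring.
Qed.

End Cons.

(** Bilinearity reduces multiplicativity to pairs of words. *)
Lemma lin_ext_shuffle h h1 h2 r g1 g2 :
    (forall s t, lin_ext h (shuffle r (xword p s) (xword p t)) = h1 s * h2 t) ->
  lin_ext h (shuffle r g1 g2) = lin_ext h1 g1 * lin_ext h2 g2.
Proof.
move=> hM; rewrite /shuffle /bilin [lin_ext h1 _]mmapE [lin_ext h2 _]mmapE.
rewrite big_distrl raddf_sum /=.
apply: eq_bigr => v _; rewrite big_distrr raddf_sum; apply: eq_bigr => w _.
rewrite /= lin_extZ -shuffle_xword hM rmorphM.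
by rewrite mulrACA.
Qed.

End LinearExtension.

Section ShuffleProduct.
Variables (R : realType) (F : finFieldType) (C : Cinfty R F).
Variables (p : nat) (f : {rmorphism 'F_p -> fps C}).

Lemma Hd_mul d (k l : posint) :
  Hd C d k * Hd C d l = Hd C d (pos (k + l)) +
  \sum_(1 <= i < k + l) f (Delta p #|F| k l (k + l - i)) *
    (Hd C d (pos i) * Hlt C d [:: pos (k + l - i)]).
Proof.
rewrite !Hd_power_sum posK ?addn_gt0 ?(valP k) //.
rewrite (power_sumM (@bracket_fps_unit _ _ C)) ?(valP k) ?(valP l) //.
congr (_ + _); apply: eq_big_nat => i /andP[i_gt0 lt_i].
have j_gt0 : (0 < k + l - i)%N by rewrite subn_gt0.
have := power_sum_lt_Hlt C d (pos (k + l - i)); rewrite posK // => ->.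
rewrite Hd_power_sum posK //.
rewrite /Delta; case: ifP => _; last by rewrite rmorph0 !(mul0r, mulr0).
rewrite rmorphD !rmorphM !rmorphXn rmorphN1 !rmorph_nat.
(* The -1 from the sum over F* accounts for the passage from (-1)^k to the (-1)^(k - 1) of
   [Delta]. *)
have sgn n : (0 < n)%N -> (-1) ^+ n = - (-1) ^+ (n - 1) :> fps C.
  by case: n => // n _; rewrite exprS mulN1r subn1.
rewrite (sgn k) ?(valP k) // (sgn l) ?(valP l) //.
by rewrite mulN1r !mulrN addrC !mulNr -opprD mulNr opprK.
Qed.

(** Stated for arbitrary elements because the last term of the shuffle recursion multiplies a
    combination of words by x_j, and the induction hypothesis is needed there too. *)
Lemma Hlt_shuffle d g1 g2 :
  lin_ext f (Hlt C d) (shuffle #|F| g1 g2) =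
  lin_ext f (Hlt C d) g1 * lin_ext f (Hlt C d) g2.
Proof.
elim: d g1 g2 => [|d IHd] g1 g2.
  apply: lin_ext_shuffle => -[|k s] t.
    by rewrite shuffle0x lin_ext_xword Hlt0 mul1r.
  case: t => [|l t]; first by rewrite shufflex0 lin_ext_xword Hlt0 mulr1.
  (* At d = 0 sums over non-empty words vanish, so the recursion holds with both coefficients 0. *)
  have h_cons m w : Hlt C 0 (m :: w) = 0 * Hlt C 0 (m :: w) + 0 * Hlt C 0 w.
    by rewrite Hlt_cons0 !mul0r addr0.
  have vanish (x y z u : fps C) n (D S : nat -> fps C) :
      0 * x + (0 * y + 0 * z + 0 * u + \sum_(1 <= i < n) D i * (0 * S i)) = 0.
    by rewrite !mul0r !add0r big1 // => i _; rewrite mul0r mulr0.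
  rewrite shuffle_cons (lin_ext_cons_sum f (c := fun=> 0) h_cons).
  transitivity (0 : fps C); first exact: vanish.
  by rewrite Hlt_cons0 mul0r.
apply: lin_ext_shuffle => -[|k s] t.
  by rewrite shuffle0x lin_ext_xword Hlt0 mul1r.
case: t => [|l t]; first by rewrite shufflex0 lin_ext_xword Hlt0 mulr1.
have h_cons m w :
    Hlt C d.+1 (m :: w) = 1 * Hlt C d (m :: w) + Hd C d m * Hlt C d w.
  by rewrite HltS mul1r.
have IHx u v : lin_ext f (Hlt C d) (shuffle #|F| (xword p u) (xword p v)) =
    Hlt C d u * Hlt C d v.
  by rewrite IHd !lin_ext_xword.
have IHx3 u v w : lin_ext f (Hlt C d)
      (shuffle #|F| (shuffle #|F| (xword p u) (xword p v)) (xword p w)) =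
    Hlt C d u * Hlt C d v * Hlt C d w.
  by rewrite IHd IHx lin_ext_xword.
have expand (a b A B S T : fps C) : (A + a * S) * (B + b * T) =
    A * B + (a * (S * B) + b * (A * T) + a * b * (S * T)) by ring.
rewrite shuffle_cons (lin_ext_cons_sum f h_cons) !HltS expand Hd_mul.
(* The terms without a factor H_d reassemble into the same shuffle at level d; the others match one
   by one after [Hd_mul]. *)
congr (_ + _); first by rewrite mul1r -shuffle_cons IHx.
rewrite mulrDl addrA; congr (_ + _).
  by congr (_ * _ + _ * _ + _ * _); apply: IHx.
rewrite big_distrl; apply: eq_bigr => i _ /=.
have swap (x y z u v : fps C) : x * (y * (u * v * z)) = x * (y * z) * (u * v).
  by ring.
by apply: etrans (swap _ _ _ _ _); do 2!congr (_ * _); apply: IHx3.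
Qed.

End ShuffleProduct.

(** * Coefficientwise limits *)

Section Limits.
Variables (R : realType) (F : finFieldType) (C : Cinfty R F).
Implicit Types (v w : nat -> C) (l m x y : C).

Lemma natr_cardF_gt1 : 1 < (#|F|%:R : R).
Proof. by rewrite ltr1n finNzRing_gt1. Qed.

(** From 0 * t = 0 with |t| = 1/q, which is not 1. *)
Lemma cabs0 : cabs (0 : C) = 0.
Proof.
pose t : C := of_kbar C (to_kbar C (tofrac (invtheta F))).
have : cabs (0 * t) = cabs (0 : C) * #|F|%:R^-1 by rewrite cabsM cabs_invtheta.
rewrite mul0r => /eqP; rewrite -subr_eq0 -{1}[cabs 0]mulr1 -mulrBr mulf_eq0.
case/orP => [/eqP //|]; rewrite subr_eq0 eq_sym invr_eq1 => /eqP q1.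
by have := natr_cardF_gt1; rewrite q1 ltxx.
Qed.

Lemma cabsN x : cabs (- x) = cabs x.
Proof.
suff N1 : cabs (-1 : C) = 1 by rewrite -mulN1r cabsM N1 mul1r.
apply/eqP; rewrite -(@eqrXn2 _ 2) ?cabs_ge0 //.
by rewrite -cabsX sqrrN expr1n cabs1 expr1n.
Qed.

Lemma cabs_sub x y : cabs (x - y) = cabs (y - x).
Proof. by rewrite -opprB cabsN. Qed.

Lemma cabsD_lt x y e : cabs x < e -> cabs y < e -> cabs (x + y) < e.
Proof. by move=> xe ye; rewrite (le_lt_trans (cabsD x y)) // gt_max xe ye. Qed.

Lemma cabs_sum_le I (r : seq I) (P : pred I) (f : I -> C) e : 0 <= e ->
  (forall i, P i -> cabs (f i) <= e) -> cabs (\sum_(i <- r | P i) f i) <= e.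
Proof.
move=> e0 fe; apply: (big_ind (fun x => cabs x <= e)) => // [|x y xe ye].
  by rewrite cabs0.
by rewrite (le_trans (cabsD x y)) // ge_max xe ye.
Qed.

Lemma climit_cst l : climit (fun=> l) l.
Proof. by move=> e e0; exists 0%N => n _; rewrite subrr cabs0. Qed.

Lemma climitD v w l m :
  climit v l -> climit w m -> climit (fun n => v n + w n) (l + m).
Proof.
move=> vl wm e e0; have [n1 vl1] := vl e e0; have [n2 wm2] := wm e e0.
exists (maxn n1 n2) => n; rewrite geq_max => /andP[n1n n2n].
by rewrite opprD addrACA; apply: cabsD_lt; [apply: vl1|apply: wm2].
Qed.

Lemma climit_sum I (r : seq I) (P : pred I) (v : I -> nat -> C) (l : I -> C) :
    (forall i, P i -> climit (v i) (l i)) ->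
  climit (fun n => \sum_(i <- r | P i) v i n) (\sum_(i <- r | P i) l i).
Proof.
move=> vl; elim: r => [|i r IHr].
  have -> : (fun n => \sum_(i <- [::] | P i) v i n) = fun=> 0.
    by apply/funext => n; rewrite big_nil.
  by rewrite big_nil; apply: climit_cst.
have -> : (fun n => \sum_(i <- i :: r | P i) v i n) =
    fun n => (if P i then v i n else 0) + \sum_(i <- r | P i) v i n.
  by apply/funext => n; rewrite big_cons; case: ifP; rewrite ?add0r.
rewrite big_cons.
have -> : (if P i then l i + \sum_(j <- r | P j) l j
           else \sum_(j <- r | P j) l j) =
    (if P i then l i else 0) + \sum_(j <- r | P j) l j.
  by case: ifP; rewrite ?add0r.
apply: climitD => //; case: ifP => [Pi|_]; [exact: vl|exact: climit_cst].
Qed.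

Lemma climitZ c v l : climit v l -> climit (fun n => c * v n) (c * l).
Proof.
move=> vl e e0; have c1 : 0 < cabs c + 1 by rewrite ltr_wpDl ?cabs_ge0.
have [n0 vl0] := vl (e / (cabs c + 1)) (divr_gt0 e0 c1).
exists n0 => n /vl0 vln; rewrite -mulrBr cabsM.
apply: (@le_lt_trans _ _ ((cabs c + 1) * cabs (v n - l))).
  by rewrite ler_wpM2r ?cabs_ge0 ?lerDl.
by rewrite mulrC -ltr_pdivlMr.
Qed.

Lemma climit_subr0 v l : climit v l <-> climit (fun n => v n - l) 0.
Proof. by split=> vl e /vl[n0 vl0]; exists n0 => n /vl0; rewrite subr0. Qed.

Lemma climitM v w l m :
  climit v l -> climit w m -> climit (fun n => v n * w n) (l * m).
Proof.
move=> vl wm.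
have vwE n : v n * w n = (v n - l) * (w n - m) + (m * v n + l * (w n - m)).
  by ring.
have -> : (fun n => v n * w n) =
    fun n => (v n - l) * (w n - m) + (m * v n + l * (w n - m)).
  by apply/funext.
have -> : l * m = 0 + (m * l + l * 0) by rewrite mulr0 addr0 add0r mulrC.
apply: climitD.
  move=> e e0; have [n1 vl1] := vl e e0; have [n2 wm2] := wm 1 ltr01.
  exists (maxn n1 n2) => n; rewrite geq_max => /andP[n1n n2n].
  rewrite subr0 cabsM (le_lt_trans _ (vl1 n n1n)) // ler_piMr ?cabs_ge0 //.
  exact: ltW (wm2 n n2n).
by apply: climitD; apply: climitZ => //; apply: (iffLR (climit_subr0 _ _)).
Qed.

Lemma climit_unique v l m : climit v l -> climit v m -> l = m.
Proof.
move=> vl vm; apply/eqP; rewrite -subr_eq0; apply/eqP/cabs_eq0/eqP.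
rewrite eq_le cabs_ge0 andbT leNgt; apply/negP => lm0.
have [n1 vl1] := vl _ lm0; have [n2 vm2] := vm _ lm0.
suff : cabs (l - m) < cabs (l - m) by rewrite ltxx.
pose n := maxn n1 n2.
have {1}-> : l - m = (l - v n) + (v n - m) by rewrite addrA subrK.
apply: cabsD_lt; last by apply: vm2; apply: leq_maxr.
by rewrite cabs_sub; apply: vl1; apply: leq_maxl.
Qed.

Lemma climE v l : climit v l -> clim v = l.
Proof.
by move=> vl; apply: (climit_unique _ vl); apply: (@xgetI _ _ (climit v) l).
Qed.

(* The ultrametric Cauchy criterion only involves consecutive terms. *)
Lemma climit_clim v :
  climit (fun n => v n.+1 - v n) 0 -> climit v (clim v).
Proof.
move=> dv; suff [l vl] : exists l, climit v l by rewrite (climE vl).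
apply: ccar_complete => e e0; have [n0 dv0] := dv e e0; exists n0.
have close k n : (n0 <= n)%N -> cabs (v (n + k)%N - v n) < e.
  move=> n0n; elim: k => [|k IHk]; first by rewrite addn0 subrr cabs0.
  rewrite -(subrK (v (n + k)%N) (v (n + k.+1)%N)) -addrA; apply: cabsD_lt => //.
  rewrite addnS -[X in cabs X]subr0; apply: dv0.
  by rewrite (leq_trans n0n) ?leq_addr.
move=> i j n0i n0j; case: (leqP i j) => [le_ij|/ltnW le_ji].
  by rewrite cabs_sub -(subnKC le_ij) close.
by rewrite -(subnKC le_ji) close.
Qed.

Lemma exprV_cardF_lt (e : R) : 0 < e ->
  exists n0, forall n, (n0 <= n)%N -> (#|F|%:R^-1 : R) ^+ n < e.
Proof.
move=> e0; exists (Num.bound e^-1) => n le_n.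
have q0 : 0 < (#|F|%:R : R) by apply: lt_trans natr_cardF_gt1.
rewrite exprVn -[e]invrK ltf_pV2 ?posrE ?exprn_gt0 ?invr_gt0 //.
apply: lt_le_trans (archi_boundP _) _; first by rewrite invr_ge0 ltW.
rewrite -natrX ler_nat (leq_trans le_n) // ltnW // ltn_expl //.
exact: finNzRing_gt1.
Qed.

End Limits.

(** * Laurent polynomials in a and convergence of the truncated sums *)

Section Convergence.
Variables (R : realType) (F : finFieldType) (C : Cinfty R F).

(** Nothing is asked at a = 0, where [a]_u is not invertible. *)
Definition laurent (h : {poly F} -> C) : Prop :=
  exists (P : {poly C}) (m : nat),
    forall a, a != 0 -> h a = P.[iota_A C a] / iota_A C a ^+ m.

Lemma laurent_eq (h1 h2 : {poly F} -> C) :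
  (forall a, a != 0 -> h1 a = h2 a) -> laurent h2 -> laurent h1.
Proof. by move=> h12 [P [m hP]]; exists P, m => a a0; rewrite h12 ?hP. Qed.

Lemma laurent_poly (P : {poly C}) : laurent (fun a => P.[iota_A C a]).
Proof. by exists P, 0%N => a _; rewrite divr1. Qed.

Lemma laurent_cst (c : C) : laurent (fun=> c).
Proof. by exists c%:P, 0%N => a _; rewrite hornerC divr1. Qed.

Lemma laurentV : laurent (fun a => (iota_A C a)^-1).
Proof. by exists 1, 1%N => a _; rewrite hornerC mul1r. Qed.

Lemma laurentM h1 h2 : laurent h1 -> laurent h2 -> laurent (fun a => h1 a * h2 a).
Proof.
move=> [P [m hP]] [Q [n hQ]]; exists (P * Q), (m + n)%N => a a0.
by rewrite hP // hQ // hornerM mulrACA -invfM exprD.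
Qed.

Lemma laurentD h1 h2 : laurent h1 -> laurent h2 -> laurent (fun a => h1 a + h2 a).
Proof.
move=> [P [m hP]] [Q [n hQ]]; exists (P * 'X^n + Q * 'X^m), (m + n)%N => a a0.
have ia0 k : iota_A C a ^+ k != 0 by rewrite expf_neq0 // iota_A_eq0.
rewrite hP // hQ // !hornerE exprD; move: (ia0 m) (ia0 n).
move: (iota_A C a ^+ m) (iota_A C a ^+ n) => x y x0 y0.
by field; rewrite x0 y0.
Qed.

Lemma laurent_sum I (r : seq I) (P : pred I) (h : I -> {poly F} -> C) :
    (forall i, P i -> laurent (h i)) ->
  laurent (fun a => \sum_(i <- r | P i) h i a).
Proof.
move=> hP; elim: r => [|i r IHr].
  by apply: (laurent_eq _ (laurent_cst 0)) => a _; rewrite big_nil.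
case Pi: (P i); last first.
  by apply: (laurent_eq _ IHr) => a _; rewrite big_cons Pi.
by apply: (laurent_eq _ (laurentD (hP i Pi) IHr)) => a _; rewrite big_cons Pi.
Qed.

(** Strong induction on n: comparing coefficients in [a]_u [a]_u^(-1) = 1 gives the n-th one from
    earlier ones, dividing only by the constant term a. *)
Lemma laurent_bracketV n : laurent (fun a => fcoef (bracket_fps C a)^-1 n).
Proof.
elim/ltn_ind: n => n IHn.
pose h a := (iota_A C a)^-1 * ((n == 0%N)%:R -
  \sum_(i < n) fcoef (bracket_fps C a) i.+1 * fcoef (bracket_fps C a)^-1 (n - i.+1)).
apply: (@laurent_eq _ h) => [a a0|].
  have ia0 : iota_A C a != 0 by rewrite iota_A_eq0.
  have /fpsP /(_ n) := mulrV (bracket_fps_unit C a0).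
  rewrite fcoefM big_ord_recl fcoef_bracket0 subn0 => abE.
  apply: (mulfI ia0); rewrite mulVKf //; apply/eqP; rewrite eq_sym subr_eq eq_sym.
  by apply/eqP.
apply: laurentM; first exact: laurentV.
apply: laurentD; first exact: laurent_cst.
apply: (@laurent_eq _ (fun a => -1 * \sum_(i < n) fcoef (bracket_fps C a) i.+1
    * fcoef (bracket_fps C a)^-1 (n - i.+1))) => [a _|]; first by rewrite mulN1r.
apply: laurentM; first exact: laurent_cst.
apply: laurent_sum => i _; apply: laurentM; last first.
  by apply: IHn; rewrite ltn_subrL (leq_ltn_trans _ (ltn_ord i)).
by apply: (laurent_eq _ (laurent_poly (bracket_coef C i.+1))) => a _; apply: fcoef_bracket.
Qed.

Lemma laurent_bracketXV k n : laurent (fun a => fcoef (bracket_fps C a ^- k) n).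
Proof.
elim: k n => [|k IHk] n.
  by apply: (laurent_eq _ (laurent_cst (fcoef (1 : fps C) n))) => a _; rewrite invr1.
apply: (@laurent_eq _ (fun a => \sum_(i < n.+1)
   fcoef (bracket_fps C a)^-1 i * fcoef (bracket_fps C a ^- k) (n - i))) => [a a0|].
  by rewrite exprS invrM ?unitrX ?bracket_fps_unit // mulrC fcoefM.
by apply: laurent_sum => i _; apply: laurentM => //; apply: laurent_bracketV.
Qed.

(* Nonnegative powers of a sum to 0 over all monic a of large degree, negative
   powers are small individually. *)
Lemma climit_sum_laurent (h : {poly F} -> C) : laurent h ->
  climit (fun d => \sum_(g : {poly_d F}) h ('X^d + polyn g)) 0.
Proof.
case=> P [m hP].
have -> : (fun d => \sum_(g : {poly_d F}) h ('X^d + polyn g)) = (fun d =>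
    \sum_(i < size P) P`_i * \sum_(g : {poly_d F})
      iota_A C ('X^d + polyn g) ^+ i / iota_A C ('X^d + polyn g) ^+ m).
  apply/funext => d; under [RHS]eq_bigr => i _ do rewrite big_distrr /=.
  rewrite exchange_big; apply: eq_bigr => g _ /=.
  rewrite hP ?monic_sum_neq0 // horner_coef big_distrl.
  by apply: eq_bigr => i _; rewrite mulrA.
rewrite -[X in climit _ X](@big1 _ _ +%R _ (index_enum 'I_(size P)) predT
  (fun i => P`_i * 0)) => [|i _]; last by rewrite mulr0.
apply: climit_sum => i _; apply: climitZ => e e0.
have ia0 d (g : {poly_d F}) : iota_A C ('X^d + polyn g) != 0.
  by rewrite iota_A_eq0 monic_sum_neq0.
have [le_mi|lt_im] := leqP m i.
  (* This is the size of X^(i - m), from which degree bound on its values sum to 0. *)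
  exists (i - m).+1 => d lt_d; rewrite subr0.
  suff -> : \sum_(g : {poly_d F})
      iota_A C ('X^d + polyn g) ^+ i / iota_A C ('X^d + polyn g) ^+ m = 0.
    by rewrite cabs0.
  rewrite -[RHS](@npoly_sum_horner0 _ _ (iota_A C) 'X^(i - m) d (iota_A C 'X^d)).
  - apply: eq_bigr => g _; rewrite !hornerE -rmorphD -{1}(subnK le_mi) exprD.
    by rewrite mulfK // expf_neq0.
  - exact: natr_card_rmorph (iota_A C \o polyC).
  - by rewrite size_polyXn.
have [n0 small] := @exprV_cardF_lt R F e e0; exists n0 => d /small lt_e; rewrite subr0.
apply: le_lt_trans lt_e; apply: cabs_sum_le => [|g _].
  by rewrite exprn_ge0 // invr_ge0 ler0n.
have szE : (size ('X^d + polyn g)%R).-1 = d.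
  by rewrite size_polyDl size_polyXn // ltnS size_npoly.
have absE : cabs (iota_A C ('X^d + polyn g)) = #|F|%:R ^+ d.
  by rewrite cabs_iota_A ?monic_sum_neq0 // szE.
have q_gt0 : 0 < (#|F|%:R : R) by rewrite ltr0n; apply: ltnW (finNzRing_gt1 F).
have -> : iota_A C ('X^d + polyn g) ^+ i / iota_A C ('X^d + polyn g) ^+ m =
    (iota_A C ('X^d + polyn g))^-1 ^+ (m - i).
  by rewrite -{1}(subnKC (ltnW lt_im)) exprD invfM mulVKf ?expf_neq0 // exprVn.
have absV : cabs (iota_A C ('X^d + polyn g))^-1 = (#|F|%:R^-1) ^+ d.
  apply: (@mulfI _ (#|F|%:R ^+ d)); first by rewrite expf_neq0 ?gt_eqF.
  rewrite -{1}absE -cabsM divff // cabs1 exprVn divff //.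
  by rewrite expf_neq0 ?gt_eqF.
rewrite cabsX absV -exprM ler_wiXn2l ?invr_ge0 ?ler0n ?invf_le1 ?ler1n //.
  exact: ltnW (finNzRing_gt1 F).
by rewrite leq_pmulr // subn_gt0.
Qed.

Lemma climit_Hd k n : climit (fun d => fcoef (Hd C d k) n) 0.
Proof.
have := climit_sum_laurent (laurent_bracketXV k n).
congr climit; apply/funext => d.
by rewrite Hd_power_sum fcoef_sum.
Qed.

Lemma climit_fcoefM (f g : nat -> fps C) (a b : fps C) n :
    (forall i, climit (fun d => fcoef (f d) i) (fcoef a i)) ->
    (forall i, climit (fun d => fcoef (g d) i) (fcoef b i)) ->
  climit (fun d => fcoef (f d * g d) n) (fcoef (a * b) n).
Proof.
move=> fa gb; rewrite fcoefM; have -> : (fun d => fcoef (f d * g d) n) =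
    fun d => \sum_(i < n.+1) fcoef (f d) i * fcoef (g d) (n - i) by [].
by apply: climit_sum => i _; apply: climitM.
Qed.

(** Induction on depth: consecutive differences are coefficients of H_d(k) H_{<d}(s), which tend to
    those of 0 times [zeta_u C s]. Hence [clim] is a genuine limit here, not its default value. *)
Lemma climit_Hlt s n :
  climit (fun d => fcoef (Hlt C d s) n) (fcoef (zeta_u C s) n).
Proof.
elim: s n => [|k s IHs] n; rewrite [fcoef (zeta_u C _) n]/=; apply: climit_clim.
  have -> : (fun d => fcoef (Hlt C d.+1 [::]) n - fcoef (Hlt C d [::]) n) = fun=> 0.
    by apply/funext => d; rewrite !Hlt0 subrr.
  exact: climit_cst.
have -> : (fun d => fcoef (Hlt C d.+1 (k :: s)) n - fcoef (Hlt C d (k :: s)) n) =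
    fun d => fcoef (Hd C d k * Hlt C d s) n.
  by apply/funext => d; rewrite HltS fcoefD addrC addKr.
have -> : (0 : C) = fcoef (0 * zeta_u C s) n by rewrite mul0r.
by apply: climit_fcoefM => // i; apply: climit_Hd.
Qed.

End Convergence.

(** * Exponents of zeta_u and passage to the limit *)

Section Support.
Variables (K : fieldType) (m : nat).
Implicit Types f g : fps K.

Definition supported f := forall n, ~~ (m %| n)%N -> fcoef f n = 0.

Lemma supported1 : supported 1.
Proof. by move=> [|n]; rewrite ?dvdn0. Qed.

Lemma supported_sum I (r : seq I) (P : pred I) (f : I -> fps K) :
  (forall i, P i -> supported (f i)) -> supported (\sum_(i <- r | P i) f i).
Proof.
by move=> sf n mn; rewrite fcoef_sum big1 // => i Pi; apply: sf.
Qed.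

Lemma supportedM f g : supported f -> supported g -> supported (f * g).
Proof.
move=> sf sg n mn; rewrite fcoefM big1 // => i _.
have [mi|mi] := boolP (m %| i)%N; last by rewrite sf ?mul0r.
rewrite sg ?mulr0 //; apply: contra mn => mni.
have le_in : (i <= n)%N by rewrite -ltnS.
by rewrite -(subnKC le_in) dvdn_add.
Qed.

Lemma supportedX f n : supported f -> supported (f ^+ n).
Proof.
move=> sf; elim: n => [|n IHn]; first exact: supported1.
by rewrite exprS; apply: supportedM.
Qed.

(** Strong induction on n: in the n-th coefficient of f f^(-1) = 1, every term except f_0 (f^(-1))_n
    vanishes, since m cannot divide both i and n - i. *)
Lemma supportedV f : f \is a GRing.unit -> supported f -> supported f^-1.
Proof.
move=> f_unit sf; elim/ltn_ind => n IHn mn.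
have f0 : fcoef f 0 != 0 by rewrite -fps_unitE.
have /fpsP /(_ n) := mulrV f_unit.
rewrite fcoefM big_ord_recl big1 => [|i _].
  rewrite addr0 subn0 [RHS]supported1 // => /eqP.
  by rewrite mulf_eq0 (negPf f0) => /eqP.
have [mi|mi] := boolP (m %| i.+1)%N; last by rewrite sf ?mul0r.
rewrite IHn ?mulr0 //.
  by rewrite ltn_subrL (leq_ltn_trans _ (ltn_ord i)).
by apply: contra mn => mni; rewrite -(subnKC (ltn_ord i)) dvdn_add.
Qed.

End Support.

Section Zeta.
Variables (R : realType) (F : finFieldType) (C : Cinfty R F).

Lemma supported_Hlt d s : supported (#|F| - 1) (Hlt C d s).
Proof.
elim: s d => [|k s IHs] d; first by rewrite Hlt0; apply: supported1.
rewrite Hlt_rec /=; apply: supported_sum => i _; rewrite -Hlt_rec.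
apply: supportedM => //; rewrite Hd_power_sum; apply: supported_sum => g _.
rewrite -exprVn; apply/supportedX/supportedV.
  by apply: bracket_fps_unit; apply: monic_sum_neq0.
by move=> n; apply: fcoef_bracket_eq0.
Qed.

Lemma supported_zeta_u s : supported (#|F| - 1) (zeta_u C s).
Proof.
move=> n mn; apply: climit_unique (climit_Hlt C s n) _.
have -> : (fun d => fcoef (Hlt C d s) n) = fun=> 0.
  by apply/funext => d; apply: supported_Hlt.
exact: climit_cst.
Qed.

End Zeta.

(** * Coefficients in F_p and passage to the limit *)

Section FpEmbedding.
Variables (p : nat) (p_prime : prime p) (K : comNzRingType) (pK : p \in [pchar K]).

(** The coefficient map of [gamma_hat]; characteristic p makes it a ring morphism. *)
Definition Fp_natr (c : 'F_p) : K := (c : nat)%:R.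

Fact Fp_natr_nat n : Fp_natr n%:R = n%:R.
Proof. by rewrite /Fp_natr val_Fp_nat // GRing.natr_mod_pchar. Qed.

Fact Fp_natr_zmod_morphism : zmod_morphism Fp_natr.
Proof.
have Fp_natrD u v : Fp_natr (u + v) = Fp_natr u + Fp_natr v.
  by rewrite -[u in LHS]natr_Zp -[v in LHS]natr_Zp -natrD Fp_natr_nat natrD.
by move=> a b; apply: (addIr (Fp_natr b)); rewrite subrK -Fp_natrD subrK.
Qed.

Fact Fp_natr_monoid_morphism : monoid_morphism Fp_natr.
Proof.
split=> [|a b]; first exact: (Fp_natr_nat 1).
by rewrite -[a in LHS]natr_Zp -[b in LHS]natr_Zp -natrM Fp_natr_nat natrM.
Qed.

Definition Fp_embedding : {rmorphism 'F_p -> K} :=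
  HB.pack Fp_natr
    (GRing.isZmodMorphism.Build 'F_p K Fp_natr Fp_natr_zmod_morphism)
    (GRing.isMonoidMorphism.Build 'F_p K Fp_natr Fp_natr_monoid_morphism).

End FpEmbedding.

Lemma sum_dvdn_multiples (V : nmodType) m N (G : nat -> V) : (0 < m)%N ->
    (forall i, ~~ (m %| i)%N -> G i = 0) ->
  \sum_(i < (N * m).+1) G i = \sum_(k < N.+1) G (k * m)%N.
Proof.
move=> m_gt0 G0; rewrite (bigID (fun i : 'I_ _ => m %| i)%N) /=.
rewrite [X in _ + X]big1 ?addr0 => [|i /G0 //].
have lt_km (k : 'I_N.+1) : (k * m < (N * m).+1)%N.
  by rewrite ltnS leq_mul2r -ltnS ltn_ord orbT.
have lt_im (i : 'I_(N * m).+1) : (i %/ m < N.+1)%N.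
  have := leq_div2r m (leq_ord i); rewrite mulnK //.
rewrite (reindex_onto (fun k => Ordinal (lt_km k)) (fun i => Ordinal (lt_im i))) /=.
  apply: eq_big => // k; rewrite dvdn_mull //=.
  by apply/eqP/val_inj; rewrite /= mulnK.
by move=> i mi; apply: val_inj; rewrite /= divnK.
Qed.

Section GammaHat.
Variables (R : realType) (F : finFieldType) (C : Cinfty R F).
Variables (p : nat) (p_prime : prime p) (pF : p \in [pchar F]).

Let pC : p \in [pchar C] := rmorph_pchar (iota_A C \o polyC) pF.
Let pS : p \in [pchar fps C] := rmorph_pchar (@fps_const C) pC.

(** The limit is written as an [mmap] so that at n = N (q - 1) it unfolds to [gamma_hat]. *)
Lemma climit_lin_ext (g : shuffle_space p) n :
  climit (fun d => fcoef (lin_ext (Fp_embedding p_prime pS) (Hlt C d) g) n)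
    (mmap (fun c : 'F_p => (c : nat)%:R)
      (fun w : {fmonom posint} => fcoef (zeta_u C w) n) g).
Proof.
rewrite mmapE.
have -> : (fun d => fcoef (lin_ext (Fp_embedding p_prime pS) (Hlt C d) g) n) =
    fun d => \sum_(w <- msupp g) ((g@_w : nat)%:R : C) * fcoef (Hlt C d w) n.
  apply/funext => d; rewrite /lin_ext mmapE fcoef_sum; apply: eq_bigr => w _.
  by rewrite /= /Fp_natr -fcoef_constM rmorph_nat.
by apply: climit_sum => w _; apply: climitZ; apply: climit_Hlt.
Qed.

Lemma gamma_hat_xword N s : gamma_hat C N (xword p s) = gamma C N s.
Proof.
exact: (lin_ext_xword (Fp_embedding p_prime pC) (gamma C N) s).
Qed.

(** Both sides are limits of the same sequence, by multiplicativity at each finite level d. *)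
Lemma gamma_hat_shuffle r s N :
  gamma_hat C N (shuffle #|F| (xword p r) (xword p s)) =
  fcoef (zeta_u C r * zeta_u C s) (N * (#|F| - 1)).
Proof.
apply: climit_unique (climit_lin_ext _ _) _.
have -> : (fun d => fcoef (lin_ext (Fp_embedding p_prime pS) (Hlt C d)
      (shuffle #|F| (xword p r) (xword p s))) (N * (#|F| - 1))%N) =
    fun d => fcoef (Hlt C d r * Hlt C d s) (N * (#|F| - 1))%N.
  by apply/funext => d; rewrite Hlt_shuffle !lin_ext_xword.
by apply: climit_fcoefM => i; apply: climit_Hlt.
Qed.

End GammaHat.

Theorem theorem4p12 (R : realType) (p e : nat) (p_prime : prime p)
    (e_gt0 : (0 < e)%N) (F : finFieldType) (cardF : #|F| = (p ^ e)%N)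
    (C : Cinfty R F) (r s : Index) (N : nat) :
  gamma_hat C N (shuffle #|F| (xword p r) (xword p s)) =
  \sum_(k < N.+1) gamma_hat C k (xword p r) * gamma_hat C (N - k) (xword p s).
Proof.
have pF : p \in [pchar F] := card_finPcharP cardF p_prime.
rewrite gamma_hat_shuffle // fcoefM.
have m_gt0 : (0 < #|F| - 1)%N by rewrite subn_gt0 finNzRing_gt1.
(* In the Cauchy product at N (q - 1) only the indices i = k (q - 1) contribute. *)
rewrite (sum_dvdn_multiples N (G := fun i => fcoef (zeta_u C r) i *
  fcoef (zeta_u C s) (N * (#|F| - 1) - i)) m_gt0) => [|i mi]; last first.
  by rewrite (supported_zeta_u C r mi) mul0r.
by apply: eq_bigr => k _; rewrite !gamma_hat_xword // /gamma mulnBl.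
Qed.
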